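(* Let $n=7$ and let $\mathcal{W}\subset(\mathbb{R}^{28})^{\otimes5}$ be the set defined below. Let $\mathcal{C}\in(\mathbb{R}^2)^{\otimes6}$ be the symmetric tensor of $x^6-3y^6$ and $\mathcal{C}_c\in(\mathbb{R}^{28})^{\otimes6}$ its $14$ clone. Then $\mathcal{W}$ has $5152$ elements, $\operatorname{SAdj}(\mathcal{C}_c,\mathcal{W})\in(\mathbb{R}^{5180})^{\otimes6}$ is a symmetric tensor, its real rank is $30913$ and its real symmetric rank is $30914$.
   Context: All tensors are real; rank = minimal number of decomposable summands $v_1\otimes\cdots\otimes v_6$, symmetric rank = minimal number of summands $\lambda v^{\otimes6}$. Symmetric tensors correspond to forms via $\mathcal{T}\leftrightarrow\sum_k\mathcal{T}(k_1|\dots|k_m)x_{k_1}\cdots x_{k_m}$ ($x_1=x,x_2=y$). Clone: with $E=\{1,\dots,2n\}$, $\mathcal{E}=\{2n+1,\dots,4n\}$, the $2n$ clone of $\mathcal{U}\in(\mathbb{R}^2)^{\otimes m}$ is $\mathcal{U}_c\in(\mathbb{R}^{4n})^{\otimes m}$ with $\mathcal{U}_c(k_1|\dots|k_m)=\mathcal{U}(h_1|\dots|h_m)$, $h_i=1$ if $k_i\in E$, $h_i=2$ if $k_i\in\mathcal{E}$. The set $\mathcal{W}$ (for general $n\ge5$): for $i\in\{1,\dots,n\}$ let $\alpha_i\in\mathbb{R}^{2n}$ have entries $1$ at positions $2i-1$ and $2i$ and $0$ elsewhere. For $a,b\in\mathbb{R}^{2n}$ write $(a|b)\in\mathbb{R}^{4n}$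 for the concatenation. With $1\le i_1<i_2<i_3<i_4\le n$ and $1\le k_1<k_2\le n$ ranging over all choices, let $U$ be the set of vectors of the following 16 types: $(\alpha_{i_1}+\alpha_{i_2}+\alpha_{i_3}+\alpha_{i_4}|0)$, $(\alpha_{i_1}+\alpha_{i_2}+\alpha_{i_3}|0)$, $(\alpha_{i_1}+\alpha_{i_2}|0)$, $(\alpha_{i_1}|0)$, $(\alpha_{i_1}+\alpha_{i_2}+\alpha_{i_3}+\alpha_{i_4}|\alpha_{k_1})$, $(\alpha_{i_1}+\alpha_{i_2}|\tfrac{(n-2)^2}{(n-3)(n-1)}\alpha_{k_1})$, $(\alpha_{i_1}|\tfrac{n-2}{n-3}\alpha_{k_1})$, $(\alpha_{i_1}|\tfrac{n-1}{n-4}\alpha_{k_1})$, $(\alpha_{i_1}+\alpha_{i_2}+\alpha_{i_3}|\alpha_{k_1}+\alpha_{k_2})$, $(\alpha_{i_1}+\alpha_{i_2}|\tfrac{n-2}{n-3}(\alpha_{k_1}+\alpha_{k_2}))$, $(\alpha_{i_1}+\alpha_{i_2}|\tfrac{n-2}{n-4}\alpha_{k_1})$, $(0|\alpha_{k_1})$, $(\alpha_{i_1}+\alpha_{i_2}+\alpha_{i_3}|\tfrac{n-3}{n-4}\alpha_{k_1})$, $(\alpha_{i_1}+\alpha_{i_2}+\alpha_{i_3}|\tfrac{n-2}{n-1}\alpha_{k_1})$, $(\alpha_{i_1}|\tfrac{n-1}{n-3}(\alpha_{k_1}+\alpha_{k_2}))$, $(0|\alpha_{k_1}+\alpha_{k_2})$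 (in types using only $i_1$, or only $k_1$, the other indices are absent; $k_1$ alone ranges over $\{1,\dots,n\}$). Let $\pi:\mathbb{R}^{4n}\to\mathbb{R}^{4n}$, $\pi(a_1,\dots,a_{2n},b_1,\dots,b_{2n})=(b_2,\dots,b_{2n},b_1,a_2,\dots,a_{2n},a_1)$. Set $\mathcal{W}_1=\{u^{\otimes5}:u\in U\}$, $\mathcal{W}_2=\{(\pi u)^{\otimes5}:u\in U\}$, $\mathcal{W}=\mathcal{W}_1\cup\mathcal{W}_2\subset(\mathbb{R}^{4n})^{\otimes5}$. Symmetric adjoining: index $\mathcal{W}$ by itself, a set disjoint from $I=\{1,\dots,4n\}$; $\operatorname{SAdj}(\mathcal{C}_c,\mathcal{W})\in(\mathbb{R}^{I\cup\mathcal{W}})^{\otimes6}$ has entry $\mathcal{C}_c(k_1|\dots|k_6)$ when all $k_i\in I$, entry $w(k_1|\dots|\widehat{k_j}|\dots|k_6)$ when exactly the $j$th index is an element $w\in\mathcal{W}$ and all others lie in $I$, and $0$ otherwise. *)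

(* Defs.v *)
From HB Require Import structures.
From mathcomp Require Import all_boot all_order all_algebra.
From mathcomp Require Import perm reals.
Set Implicit Arguments. Unset Strict Implicit. Unset Printing Implicit Defensive.
Import Order.TTheory GRing.Theory Num.Theory.
Local Open Scope ring_scope.

Section Tensors.
Variable R : realType.

Definition tensor (I : finType) (m : nat) := {ffun {ffun 'I_m -> I} -> R}.

Definition symmetric_tensor (I : finType) m (T : tensor I m) : Prop :=
  forall (s : {perm 'I_m}) (k : {ffun 'I_m -> I}),
    T [ffun i : 'I_m => k (s i)] = T k.

Definition rank_le (I : finType) m (T : tensor I m) (r : nat) : Prop :=
  exists v : 'I_r -> 'I_m -> I -> R,
    T = [ffun k : {ffun 'I_m -> I} => \sum_(j < r) \prod_(i < m) v j i (k i)].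

Definition sym_rank_le (I : finType) m (T : tensor I m) (r : nat) : Prop :=
  exists (lam : 'I_r -> R) (v : 'I_r -> I -> R),
    T = [ffun k : {ffun 'I_m -> I} => \sum_(j < r) lam j * \prod_(i < m) v j (k i)].

Definition is_rank (I : finType) m (T : tensor I m) (r : nat) : Prop :=
  rank_le T r /\ forall r', rank_le T r' -> (r <= r')%N.

Definition is_sym_rank (I : finType) m (T : tensor I m) (r : nat) : Prop :=
  sym_rank_le T r /\ forall r', sym_rank_le T r' -> (r <= r')%N.

Definition tensor_form (I : finType) m (T : tensor I m) (x : I -> R) : R :=
  \sum_(k : {ffun 'I_m -> I}) T k * \prod_(i < m) x (k i).

Definition tpow (I : finType) m (u : I -> R) : tensor I m :=
  [ffun k : {ffun 'I_m -> I} => \prod_(i < m) u (k i)].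

Definition clone (n : nat) m (U : tensor 'I_2 m) : tensor 'I_(4 * n) m :=
  [ffun k : {ffun 'I_m -> 'I_(4 * n)} => U [ffun i => if (k i < 2 * n)%N then ord0 else ord_max]].

Definition vnat N (x : 'I_N -> R) (q : nat) : R :=
  if (insub q : option 'I_N) is Some i then x i else 0.

Definition alpha n (i : 'I_n) : 'I_(2 * n) -> R :=
  fun p => ((p %/ 2)%N == val i)%:R.

Definition asum n (A : {set 'I_n}) : 'I_(2 * n) -> R :=
  fun p => \sum_(i in A) alpha i p.

Definition ksub n (k : nat) : seq {set 'I_n} :=
  enum [pred A : {set 'I_n} | #|A| == k].

Definition cat2 n (a b : 'I_(2 * n) -> R) : 'I_(4 * n) -> R :=
  fun p => if (p < 2 * n)%N then vnat a p else vnat b (p - 2 * n).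

Definition utype n (a b : nat) (c : R) : seq ('I_(4 * n) -> R) :=
  [seq cat2 (asum A) (fun p => c * asum B p) | A <- ksub n a, B <- ksub n b].

Definition Ulist n : seq ('I_(4 * n) -> R) :=
  let nr : R := n%:R in
  utype n 4 0 1 ++ utype n 3 0 1 ++ utype n 2 0 1 ++ utype n 1 0 1 ++
  utype n 4 1 1 ++
  utype n 2 1 ((nr - 2) ^+ 2 / ((nr - 3) * (nr - 1))) ++
  utype n 1 1 ((nr - 2) / (nr - 3)) ++
  utype n 1 1 ((nr - 1) / (nr - 4)) ++
  utype n 3 2 1 ++
  utype n 2 2 ((nr - 2) / (nr - 3)) ++
  utype n 2 1 ((nr - 2) / (nr - 4)) ++
  utype n 0 1 1 ++
  utype n 3 1 ((nr - 3) / (nr - 4)) ++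
  utype n 3 1 ((nr - 2) / (nr - 1)) ++
  utype n 1 2 ((nr - 1) / (nr - 3)) ++
  utype n 0 2 1.

(* pi(a_1..a_2n, b_1..b_2n) = (b_2,..,b_2n,b_1,a_2,..,a_2n,a_1), 0-based *)
Definition piv n (x : 'I_(4 * n) -> R) : 'I_(4 * n) -> R :=
  fun p => vnat x (if (p < 2 * n)%N then (2 * n + (p.+1 %% (2 * n)))%N
                   else ((p - 2 * n).+1 %% (2 * n))%N).

Definition Wlist n : seq (tensor 'I_(4 * n) 5) :=
  undup ([seq tpow 5 u | u <- Ulist n] ++ [seq tpow 5 (piv u) | u <- Ulist n]).

Definition AdjIdx (I : finType) (Ws : seq (tensor I 5)) : finType :=
  (I + seq_sub Ws)%type.

Definition SAdj (I : finType) (Cc : tensor I 6) (Ws : seq (tensor I 5))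
  : tensor (AdjIdx Ws) 6 :=
  [ffun k : {ffun 'I_6 -> AdjIdx Ws} =>
    if [pick k' : {ffun 'I_6 -> I} | k == [ffun i => inl (k' i)]] is Some k'
    then Cc k'
    else if [pick jwk : ('I_6 * seq_sub Ws * {ffun 'I_5 -> I})%type |
               (k jwk.1.1 == inr jwk.1.2) &&
               [forall t, k (lift jwk.1.1 t) == inl (jwk.2 t)]] is Some jwk
    then (val jwk.1.2) jwk.2
    else (0 : R)].

End Tensors.

(* Main.v *)
(** Let [N = 5152] be the number of vectors [u] with [u ^ 5] in [W].  The adjoined
    tensor is [X^6 - 3 Y^6] plus, for each direction [j] and each [u], the rank one
    tensor with the new unit vector at [j] and [u] elsewhere.

    The [u ^ 5] are independent, so in any decomposition one can select for each
    direction [N] terms whose new components form a basis, and project them away;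
    the remaining terms decompose [X^6 - 3 Y^6] modulo [W].  At six positions of one
    block in different pairs all corrections vanish, so this class is nonzero and
    the rank is at least [6 N + 1]; it is attained because [W] spans the mixed parts
    of [(X + Y)^5], so that [X^6 - 3 Y^6] is congruent to [(X + Y)^5 (X - 3 Y)].

    If a symmetric decomposition had [6 N + 1] terms, the one left over would yield
    a rank one tensor [g1 .. g6] congruent to [X^6 - 3 Y^6].  If two of the [gi] are not
    proportional, dualising a selected basis in a third direction writes elements of
    the span of [W] as a rank one tensor plus a multiple of the product of the other
    [gi]; symmetry forces this multiple to be 0, hence the left-over vector has no
    new component and all the [gi] coincide.  So they are proportional, and the
    entries [1] and [-3] give a real number whose sixth power is [-3]. *)
Require Import Defs.
From HB Require Import structures.
From mathcomp Require Import all_boot all_order all_algebra.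
From mathcomp Require Import perm reals ring lra zify.
Set Implicit Arguments. Unset Strict Implicit. Unset Printing Implicit Defensive.
Import Order.TTheory GRing.Theory Num.Theory.
Local Open Scope ring_scope.

(** * Selecting and eliminating adjoined slices *)

(** No nonzero functional [y] kills all the vectors [m j] with [P j], so they span and contain a
    basis; [z] inverts the matrix of that basis. *)
Lemma basis_selection (F : fieldType) (W : finType) r (m : 'I_r -> W -> F)
    (P : pred 'I_r) :
  (forall y : W -> F, (forall j, P j -> \sum_w y w * m j w = 0) ->
     forall w, y w = 0) ->
  exists (f : 'I_#|W| -> 'I_r) (z : W -> 'I_#|W| -> F),
    [/\ injective f, (forall l, P (f l)),
        (forall l l', \sum_w z w l' * m (f l) w = (l == l')%:R) &
        (forall w w', \sum_l z w l * m (f l) w' = (w == w')%:R)].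
Proof.
move=> spanP.
pose M : 'M[F]_(r, #|W|) :=
  \matrix_(j, l) (if P j then m j (enum_val l) else 0).
have fullM : row_full M.
  rewrite /row_full -mxrank_tr -/(row_free M^T) -kermx_eq0.
  apply/eqP/row_matrixP => i; rewrite row0.
  have /(sub_kermxP) : (row i (kermx M^T) <= kermx M^T)%MS by apply: row_sub.
  set y := row i _ => y0.
  have yP w : y 0 (enum_rank w) = 0.
    apply: (spanP (fun w => y 0 (enum_rank w))) => j Pj.
    have := congr1 (fun A : 'rV[F]__ => A 0 j) y0.
    rewrite !mxE => yj; apply: etrans yj.
    rewrite [RHS](reindex (@enum_rank W)); last first.
      by exists (@enum_val W predT) => x _; rewrite (enum_valK, enum_rankK).
    by apply: eq_bigr => w' _; rewrite !mxE Pj enum_rankK.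
  by apply/rowP => l; rewrite [RHS]mxE -(enum_valK l) yP.
pose f := fullrankfun fullM; pose B := rowsub f M.
have Bu : B \in unitmx by rewrite -row_full_unit; exact: fullrowsub_full.
(* Rows outside [P] were set to 0 in [M], and the invertible [B] has no zero row. *)
have Pf l : P (f l).
  case: (boolP (P (f l))) => // nP.
  have B0 : row l B = 0 by apply/rowP => k; rewrite !mxE (negbTE nP).
  have := row_mul l B (invmx B); rewrite mulmxV // B0 mul0mx.
  by move/rowP => /(_ l); rewrite !mxE eqxx => /eqP; rewrite oner_eq0.
exists f, (fun w l => invmx B (enum_rank w) l).
split=> [||l l'|w w'].
- exact: fullrankfun_inj.
- exact: Pf.
- have := congr1 (fun A : 'M[F]__ => A l l') (mulmxV Bu).
  rewrite !mxE => <-; rewrite [RHS](reindex (@enum_rank W)); last first.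
    by exists (@enum_val W predT) => x _; rewrite (enum_valK, enum_rankK).
  by apply: eq_bigr => w _; rewrite !mxE Pf enum_rankK mulrC.
- have := congr1 (fun A : 'M[F]__ => A (enum_rank w) (enum_rank w')) (mulVmx Bu).
  rewrite !mxE (inj_eq enum_rank_inj) => <-.
  by apply: eq_bigr => l _; rewrite !mxE Pf enum_rankK.
Qed.

(** * The adjoined tensor and its contractions with product functionals *)

Section Adjoined.
Variables (F : fieldType) (I W : finType) (X Y : I -> F) (u : W -> I -> F).

Definition sum_fun (x : I -> F) (y : W -> F) (c : I + W) : F :=
  match c with inl p => x p | inr w => y w end.

(** The product form of [SAdj], see [SAdj_adjoined]: contraction with a product of functionals
    factors over the six directions. *)
Definition adjoined (k : 'I_6 -> I + W) : F :=
  \prod_i sum_fun X (fun=> 0) (k i) - 3 * \prod_i sum_fun Y (fun=> 0) (k i) +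
  \sum_(j < 6) \sum_w \prod_i
     (if i == j then sum_fun (fun=> 0) (fun w' => (w' == w)%:R)
      else sum_fun (u w) (fun=> 0)) (k i).

Definition dot (a x : I -> F) : F := \sum_p a p * x p.

Definition pairing (a : I -> F) (b : W -> F) (v : I + W -> F) : F :=
  dot a (v \o inl) + \sum_w b w * v (inr w).

Lemma contract_prod (a : 'I_6 -> I -> F) (b : 'I_6 -> W -> F)
    (v : 'I_6 -> I + W -> F) :
  \sum_(k : {ffun 'I_6 -> I + W}) (\prod_i v i (k i)) *
      \prod_i sum_fun (a i) (b i) (k i) = \prod_i pairing (a i) (b i) (v i).
Proof.
transitivity (\prod_(i < 6) \sum_(c : I + W) v i c * sum_fun (a i) (b i) c).
  rewrite bigA_distr_bigA /=; apply: eq_bigr => k _.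
  by rewrite -big_split.
apply: eq_bigr => i _; rewrite big_sumType /=.
by congr (_ + _); apply: eq_bigr => c _; rewrite mulrC.
Qed.

Lemma pairing_inl a b x : pairing a b (sum_fun x (fun=> 0)) = dot a x.
Proof.
by rewrite /pairing [X in _ + X]big1 ?addr0 // => w _; rewrite mulr0.
Qed.

Lemma pairing_inr a b w :
  pairing a b (sum_fun (fun=> 0) (fun w' => (w' == w)%:R)) = b w.
Proof.
rewrite /pairing /dot big1 ?add0r => [|p _]; last by rewrite mulr0.
rewrite (bigD1 w) //= eqxx mulr1 big1 ?addr0 // => w' /negbTE ->.
by rewrite mulr0.
Qed.

Lemma contract_adjoined (a : 'I_6 -> I -> F) (b : 'I_6 -> W -> F) :
  \sum_(k : {ffun 'I_6 -> I + W}) adjoined k *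
      \prod_i sum_fun (a i) (b i) (k i) =
  \prod_i dot (a i) X - 3 * \prod_i dot (a i) Y +
  \sum_j \sum_w b j w * \prod_(i | i != j) dot (a i) (u w).
Proof.
under [LHS]eq_bigr => k _ do rewrite /adjoined mulrDl mulrBl -mulrA mulr_suml.
rewrite big_split sumrB /=; congr (_ - _ + _).
- rewrite (contract_prod a b (fun=> sum_fun X (fun=> 0))).
  by apply: eq_bigr => i _; rewrite pairing_inl.
- rewrite -mulr_sumr (contract_prod a b (fun=> sum_fun Y (fun=> 0))).
  by congr (_ * _); apply: eq_bigr => i _; rewrite pairing_inl.
rewrite exchange_big /=; apply: eq_bigr => j _.
under [LHS]eq_bigr => k _ do rewrite mulr_suml.
rewrite exchange_big /=; apply: eq_bigr => w _.
rewrite (contract_prod a b (fun i => if i == j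
  then sum_fun (fun=> 0) (fun w' => (w' == w)%:R) else sum_fun (u w) (fun=> 0))).
rewrite (bigD1 j) //= eqxx pairing_inr; congr (_ * _).
by apply: eq_bigr => i /negbTE ->; rewrite pairing_inl.
Qed.

Definition delta (p q : I) : F := (q == p)%:R.

Lemma dot_delta p x : dot (delta p) x = x p.
Proof.
rewrite /dot /delta (bigD1 p) //= eqxx mul1r big1 ?addr0 // => q /negbTE ->.
by rewrite mul0r.
Qed.

Definition independent5 := forall y : W -> F,
  (forall k : 'I_5 -> I, \sum_w y w * \prod_i u w (k i) = 0) ->
  forall w, y w = 0.

Lemma prod_lift (j : 'I_6) (G : 'I_6 -> F) :
  \prod_(i | i != j) G i = \prod_(t < 5) G (lift j t).
Proof.
have -> : \prod_(i | i != j) G i = \prod_i (if i != j then G i else 1).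
  by rewrite big_mkcond.
rewrite (bigD1_ord j) //= eqxx mul1r.
by apply: eq_bigr => t _; rewrite eq_sym neq_lift.
Qed.

(** * Elimination of selected terms from an arbitrary decomposition *)

Section Decomposition.
Variables (r : nat) (lam : 'I_r -> F) (v : 'I_r -> 'I_6 -> I + W -> F).
Hypothesis indep : independent5.
Hypothesis decomp : forall k : {ffun 'I_6 -> I + W},
  adjoined k = \sum_j lam j * \prod_i v j i (k i).

Lemma contract_decomp a b :
  \prod_i dot (a i) X - 3 * \prod_i dot (a i) Y +
    \sum_j \sum_w b j w * \prod_(i | i != j) dot (a i) (u w) =
  \sum_j lam j * \prod_i pairing (a i) (b i) (v j i).
Proof.
rewrite -contract_adjoined.
under [LHS]eq_bigr => k _ do rewrite decomp mulr_suml.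
rewrite exchange_big /=; apply: eq_bigr => j _.
under [LHS]eq_bigr => k _ do rewrite -mulrA.
by rewrite -mulr_sumr contract_prod.
Qed.

Implicit Types (f : 'I_6 -> 'I_#|W| -> 'I_r) (z : 'I_6 -> W -> 'I_#|W| -> F).

(** Values on the new coordinates for which the functional extending [delta k] vanishes on the
    selected vectors of direction [d], once [z d] inverts their new components; [reduced] is then
    the projection along their span. *)
Definition killer f z (d : 'I_6) (k : I) (w : W) : F :=
  - \sum_l z d w l * v (f d l) d (inl k).

Definition reduced f z (d : 'I_6) (j : 'I_r) (k : I) : F :=
  pairing (delta k) (killer f z d k) (v j d).

Definition selects f z (d : 'I_6) :=
  (forall l l', \sum_w z d w l' * v (f d l) d (inr w) = (l == l')%:R) /\
  (forall w w', \sum_l z d w l * v (f d l) d (inr w') = (w == w')%:R).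

Lemma reduced_selected f z d l k : selects f z d -> reduced f z d (f d l) k = 0.
Proof.
case=> zf _; rewrite /reduced /pairing dot_delta /killer /=.
under eq_bigr => w _ do rewrite mulNr mulr_suml.
rewrite sumrN exchange_big /= (bigD1 l) //= [X in _ - (_ + X)]big1.
  under eq_bigr => w _ do rewrite mulrAC.
  by rewrite -mulr_suml zf eqxx mul1r addr0 subrr.
move=> l' /negbTE ll'; under eq_bigr => w _ do rewrite mulrAC.
by rewrite -mulr_suml zf eq_sym ll' mul0r.
Qed.

(* Contracting the directions before [i] with functionals that kill the terms
   outside [P] leaves the independent [u w ^ 5] as the slices in direction [i],
   so the terms in [P] still span that direction. *)
Lemma selection_step (i : 'I_6) (P : pred 'I_r) (b : 'I_6 -> I -> W -> F) :
  (forall j, ~~ P j -> exists2 d : 'I_6, (d < i)%N &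
     forall k, pairing (delta k) (b d k) (v j d) = 0) ->
  exists (f : 'I_#|W| -> 'I_r) (z : W -> 'I_#|W| -> F),
    [/\ injective f, (forall l, P (f l)),
        (forall l l', \sum_w z w l' * v (f l) i (inr w) = (l == l')%:R) &
        (forall w w', \sum_l z w l * v (f l) i (inr w') = (w == w')%:R)].
Proof.
move=> killed; apply: (basis_selection (m := fun j w => v j i (inr w))) => y y0.
apply: indep => k5.
pose k (d : 'I_6) := if unlift i d is Some t then k5 t else k5 ord0.
have kE t : k (lift i t) = k5 t by rewrite /k liftK.
pose a (d : 'I_6) := if d == i then (fun=> 0) else delta (k d).
pose c (d : 'I_6) := if d == i then y
  else if (d < i)%N then b d (k d) else (fun=> 0).
have := contract_decomp a c.
rewrite [X in X = _ -> _](_ : _ =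
  \sum_w y w * \prod_(t < 5) u w (k5 t)); last first.
  have ai0 x : dot (a i) x = 0.
    by rewrite /a eqxx /dot big1 // => p _; rewrite mul0r.
  rewrite (bigD1 i) //= ai0 mul0r (bigD1 i) //= ai0 mul0r mulr0 subr0 add0r.
  rewrite (bigD1 i) //= [X in _ + X]big1 ?addr0 => [|j ji]; last first.
    rewrite big1 // => w _.
    by rewrite (bigD1 i) 1?eq_sym //= ai0 mul0r mulr0.
  apply: eq_bigr => w _; rewrite /c eqxx prod_lift; congr (_ * _).
  apply: eq_bigr => t _.
  by rewrite /a eq_sym (negbTE (neq_lift i t)) dot_delta kE.
move=> ->; apply: big1 => j _.
have [Pj|nPj] := boolP (P j).
  rewrite (bigD1 i) //= /pairing {1}/a eqxx /dot big1 ?add0r; last first.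
    by move=> p _; rewrite mul0r.
  by rewrite /c eqxx y0 // mul0r mulr0.
have [d di kd] := killed j nPj.
have ndi : d != i by apply: contraTneq di => ->; rewrite ltnn.
by rewrite (bigD1 d) //= /a /c (negbTE ndi) di kd mul0r mulr0.
Qed.

Lemma selection_upto i : (i <= 6)%N -> exists f z,
  (forall (d d' : 'I_6) l l', (d < i)%N -> (d' < i)%N -> f d l = f d' l' ->
     d = d' /\ l = l') /\
  (forall d : 'I_6, (d < i)%N -> selects f z d).
Proof.
elim: i => [|i IHi] i6.
  have [|f [z _]] := @selection_step ord0 predT (fun _ _ _ => 0); first by [].
  by exists (fun=> f), (fun=> z).
have [f [z [injf self]]] := IHi (ltnW i6).
pose e := Ordinal i6.
pose P j := [forall d : 'I_6, (d < i)%N ==> [forall l, f d l != j]].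
have [|g [y [injg Pg yg1 yg2]]] := @selection_step e P (killer f z).
  move=> j; rewrite negb_forall => /existsP[d]; rewrite negb_imply.
  case/andP=> di; rewrite negb_forall => /existsP[l]; rewrite negbK => /eqP <-.
  by exists d => // k; apply/reduced_selected/self.
exists (fun d => if d == e then g else f d), (fun d => if d == e then y else z d).
have neq (d : 'I_6) : (d < i.+1)%N -> d != e -> (d < i)%N.
  by rewrite ltnS leq_eqVlt => /orP[/eqP di /eqP[]|//]; apply: val_inj.
split=> [d d' l l' di d'i|d di].
  case: eqP => [->|/eqP /(neq _ di) {}di]; case: eqP => [->|/eqP /(neq _ d'i) {}d'i].
  - by move=> /injg ->.
  - move=> E; have /forallP/(_ d')/implyP/(_ d'i)/forallP/(_ l') := Pg l.
    by rewrite E eqxx.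
  - move=> E; have /forallP/(_ d)/implyP/(_ di)/forallP/(_ l) := Pg l'.
    by rewrite E eqxx.
  - exact: injf.
rewrite /selects; case: eqP => [->|/eqP nd]; first by [].
by apply: self; apply: neq.
Qed.

Lemma selection : exists f z,
  (forall (d d' : 'I_6) l l', f d l = f d' l' -> d = d' /\ l = l') /\
  (forall d : 'I_6, selects f z d).
Proof.
have [f [z [H1 H2]]] := selection_upto (leqnn 6).
exists f, z; split=> [d d' l l'|d]; first by apply: H1.
by apply: H2.
Qed.

Definition selected f (j : 'I_r) := [exists d, [exists l, f d l == j]].

Lemma card_selected f :
  (forall (d d' : 'I_6) l l', f d l = f d' l' -> d = d' /\ l = l') ->
  #|[pred j | selected f j]| = (6 * #|W|)%N.
Proof.
move=> injf; pose h (p : 'I_6 * 'I_#|W|) := f p.1 p.2.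
have injh : injective h by move=> [d l] [d' l'] /injf[/= -> ->].
transitivity #|codom h|; last by rewrite card_codom // card_prod !card_ord.
apply: eq_card => j; rewrite !inE; apply/existsP/codomP.
  by case=> d /existsP[l /eqP <-]; exists (d, l).
by case=> [[d l] ->]; exists d; apply/existsP; exists l.
Qed.

(** Contracting each direction [i] with [delta (k i)] and its killer annihilates the selected terms;
    on the left each adjoined slice carries a product of five values of some [u w], which is 0. *)
Lemma reduced_entry f z (k : 'I_6 -> I) : (forall d, selects f z d) ->
  (forall (j : 'I_6) w, \prod_(i | i != j) u w (k i) = 0) ->
  \prod_i X (k i) - 3 * \prod_i Y (k i) =
  \sum_(j | ~~ selected f j) lam j * \prod_i reduced f z i j (k i).
Proof.
move=> self uk.
have := contract_decomp (fun d => delta (k d)) (fun d => killer f z d (k d)).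
rewrite [X in _ + X]big1 => [|j _]; last first.
  apply: big1 => w _; rewrite [X in _ * X](_ : _ = 0) ?mulr0 // -(uk j w).
  by apply: eq_bigr => i _; rewrite dot_delta.
have dotE x : \prod_i dot (delta (k i)) x = \prod_i x (k i).
  by apply: eq_bigr => i _; rewrite dot_delta.
rewrite addr0 !dotE => ->.
rewrite (bigID (selected f)) /= big1 ?add0r // => j.
case/existsP=> d /existsP[l /eqP <-].
by rewrite (bigD1 d) //= -/(reduced f z d _ _) reduced_selected // mul0r mulr0.
Qed.

(* Contracting direction [i] with the dual of the selected basis. *)
Lemma dual_slice f z (i : 'I_6) l (k : 'I_6 -> I) :
  (forall (d d' : 'I_6) l l', f d l = f d' l' -> d = d' /\ l = l') ->
  (forall d, selects f z d) ->
  \sum_w z i w l * \prod_(d | d != i) u w (k d) =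
  lam (f i l) * \prod_(d | d != i) reduced f z d (f i l) (k d) +
  \sum_(j | ~~ selected f j) (\sum_w z i w l * v j i (inr w)) *
     (lam j * \prod_(d | d != i) reduced f z d j (k d)).
Proof.
move=> injf self.
pose a (d : 'I_6) := if d == i then (fun=> 0) else delta (k d).
pose c (d : 'I_6) := if d == i then z i ^~ l else killer f z d (k d).
have ai0 x : dot (a i) x = 0.
  by rewrite /a eqxx /dot big1 // => p _; rewrite mul0r.
have := contract_decomp a c.
rewrite [X in X = _ -> _](_ : _ =
  \sum_w z i w l * \prod_(d | d != i) u w (k d)); last first.
  rewrite (bigD1 i) //= ai0 mul0r (bigD1 i) //= ai0 mul0r mulr0 subr0 add0r.
  rewrite (bigD1 i) //= [X in _ + X]big1 ?addr0 => [|j ji]; last first.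
    rewrite big1 // => w _.
    by rewrite (bigD1 i) 1?eq_sym //= ai0 mul0r mulr0.
  apply: eq_bigr => w _; rewrite /c eqxx; congr (_ * _).
  by apply: eq_bigr => d /negbTE di; rewrite /a di dot_delta.
have term j : lam j * \prod_d pairing (a d) (c d) (v j d) =
    (\sum_w z i w l * v j i (inr w)) *
       (lam j * \prod_(d | d != i) reduced f z d j (k d)).
  rewrite (bigD1 i) //= mulrCA; congr (_ * (_ * _)).
    by rewrite /pairing ai0 add0r /c eqxx.
  by apply: eq_bigr => d /negbTE di; rewrite /a /c di.
under [X in _ = X -> _]eq_bigr => j _ do rewrite term.
move=> ->; rewrite (bigID (selected f)) /=; congr (_ + _).
have sel : selected f (f i l).
  by apply/existsP; exists i; apply/existsP; exists l.
(* Selected terms of direction [i] have dual coordinate 1 at [l] and 0 elsewhere; those of other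
   directions contain a vanishing reduced factor. *)
rewrite (bigD1 (f i l)) //= (proj1 (self i)) eqxx mul1r [X in _ + X]big1 ?addr0 // => j.
case/andP=> /existsP[d /existsP[l' /eqP <-]] neq.
have [E|nd] := eqVneq d i.
  rewrite E in neq *; rewrite (proj1 (self i)).
  have /negbTE -> : l' != l by apply: contraNneq neq => ->.
  by rewrite mul0r.
by rewrite (bigD1 d) //= reduced_selected // mul0r !mulr0.
Qed.

End Decomposition.
End Adjoined.

(** * Lower bounds *)

(* Antisymmetrising in the first two arguments shows that the two terms agree, up
   to a scalar, on the last three; comparing then all other transpositions makes
   [D] a multiple of the fifth power of [g3], which [D e1 e2 e3 e4 e5 = 0] kills. *)
Lemma symmetric_two_terms (F : fieldType) (I : Type)
    (D : I -> I -> I -> I -> I -> F) (a1 a2 a3 a4 a5 g1 g2 g3 g4 g5 : I -> F)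
    (lam mu : F) (e1 e2 e3 e4 e5 p : I) :
  (forall x1 x2 x3 x4 x5, D x1 x2 x3 x4 x5 =
     lam * (a1 x1 * a2 x2 * a3 x3 * a4 x4 * a5 x5) +
     mu * (g1 x1 * g2 x2 * g3 x3 * g4 x4 * g5 x5)) ->
  (forall x1 x2 x3 x4 x5, D x1 x2 x3 x4 x5 = D x2 x1 x3 x4 x5) ->
  (forall x1 x2 x3 x4 x5, D x1 x2 x3 x4 x5 = D x1 x3 x2 x4 x5) ->
  D e1 e2 e3 e4 e5 = 0 ->
  [/\ g3 e1 != 0, g3 e2 != 0, g3 e3 != 0, g4 e4 != 0 & g5 e5 != 0] ->
  mu != 0 -> g1 e1 * g2 p != g1 p * g2 e1 ->
  forall x1 x2 x3 x4 x5, D x1 x2 x3 x4 x5 = 0.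
Proof.
move=> DE D12 D23 De [g31 g32 g33 g44 g55] mu0; rewrite -subr_eq0 => Dg.
set dg := _ - _ in Dg; pose da := a1 e1 * a2 p - a1 p * a2 e1.
have anti x3 x4 x5 : lam * da * (a3 x3 * a4 x4 * a5 x5) =
    - (mu * dg * (g3 x3 * g4 x4 * g5 x5)).
  apply/eqP; rewrite -subr_eq0 opprK; apply/eqP.
  transitivity (D e1 p x3 x4 x5 - D p e1 x3 x4 x5); last by rewrite D12 subrr.
  by rewrite !DE /da /dg; ring.
have lda : lam * da != 0.
  apply/eqP => lda0; have /esym/eqP := anti e3 e4 e5.
  rewrite lda0 mul0r oppr_eq0 !mulf_eq0.
  by rewrite (negbTE mu0) (negbTE Dg) (negbTE g33) (negbTE g44) (negbTE g55).
(* By [anti], the last three factors of the two terms are proportional, so they split off from [D]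
   and leave a bilinear [M]. *)
pose M x y := mu * (g1 x * g2 y) - lam * (mu * dg) / (lam * da) * (a1 x * a2 y).
have DM x1 x2 x3 x4 x5 : D x1 x2 x3 x4 x5 = M x1 x2 * (g3 x3 * g4 x4 * g5 x5).
  have -> : D x1 x2 x3 x4 x5 = mu * (g1 x1 * g2 x2) * (g3 x3 * g4 x4 * g5 x5) +
      lam * (a1 x1 * a2 x2) * (lam * da * (a3 x3 * a4 x4 * a5 x5)) / (lam * da).
    by rewrite DE; field; move: lda; rewrite mulf_eq0 negb_or => /andP[-> ->].
  rewrite anti /M; field.
  by move: lda; rewrite mulf_eq0 negb_or => /andP[-> ->].
have gg : g4 e4 * g5 e5 != 0 by rewrite mulf_neq0.
have M12 x y : M x y = M y x.
  have := D12 x y e3 e4 e5; rewrite !DM; apply: mulIf.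
  by rewrite !mulf_neq0.
have M23 x y z : M x y * g3 z = M x z * g3 y.
  have := D23 x y z e4 e5; rewrite !DM -!(mulrA (g3 _)) !mulrA -!(mulrA _ (g4 _)).
  by apply: mulIf.
(* The zero of [D] gives one zero of [M]; the exchange rule [M23] spreads it to the row of [e2],
   then to all of [M]. *)
have Me : M e1 e2 = 0.
  move/eqP: De; rewrite DM !mulf_eq0 (negbTE g33) (negbTE g44) (negbTE g55).
  by rewrite !orbF => /eqP.
have Me2 x : M e2 x = 0.
  have := M23 e2 e1 x; rewrite M12 Me mul0r => /esym/eqP.
  by rewrite mulf_eq0 (negbTE g31) orbF => /eqP.
move=> x1 x2 x3 x4 x5; rewrite DM.
have /eqP := M23 x1 e2 x2; rewrite M12 Me2 mul0r eq_sym mulf_eq0 (negbTE g32).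
by rewrite orbF => /eqP ->; rewrite mul0r.
Qed.

(** Serves to move two non-proportional factors into the first two slots. *)
Lemma two_point_perm n (t1 t2 : 'I_n.+2) : t1 != t2 ->
  exists s : {perm 'I_n.+2}, s ord0 = t1 /\ s (lift ord0 ord0) = t2.
Proof.
move=> t12; set one := lift ord0 ord0.
pose z := tperm ord0 t1 t2; exists (tperm one z * tperm ord0 t1)%g.
have z0 : z != ord0.
  by rewrite /z -(inj_eq (@perm_inj _ (tperm ord0 t1))) tpermK tpermL eq_sym.
rewrite !permM; split; first by rewrite (_ : tperm one z ord0 = ord0) ?tpermL // tpermD.
by rewrite tpermL /z tpermK.
Qed.

Lemma prod_ord5 (F : fieldType) (G : 'I_5 -> F) :
  \prod_t G t = G (inord 0) * G (inord 1) * G (inord 2) * G (inord 3) * G (inord 4).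
Proof.
rewrite !big_ord_recr big_ord0 /= mul1r.
by do !congr (_ * _); congr (G _); apply: val_inj; rewrite /= inordK.
Qed.

(** A combination of fifth powers is symmetric, so its arguments can be permuted until [t1] and [t2]
    come first; then [symmetric_two_terms] applies. *)
Lemma power_sum_two_terms (F : fieldType) (I W : finType) (u : W -> I -> F)
    (y : W -> F) (a g : 'I_5 -> I -> F) (lam mu : F) (e : 'I_5 -> I) (p : I) t1 t2 :
  (forall m : 'I_5 -> I, \sum_w y w * \prod_t u w (m t) =
     lam * \prod_t a t (m t) + mu * \prod_t g t (m t)) ->
  \sum_w y w * \prod_t u w (e t) = 0 ->
  (forall t t', g t (e t') != 0) -> mu != 0 ->
  t1 != t2 -> g t1 (e ord0) * g t2 p != g t1 p * g t2 (e ord0) ->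
  forall m : 'I_5 -> I, \sum_w y w * \prod_t u w (m t) = 0.
Proof.
move=> DE De ge mu0 /two_point_perm[s [s0 s1]] nprop m.
pose D x1 x2 x3 x4 x5 := \sum_w y w * (u w x1 * u w x2 * u w x3 * u w x4 * u w x5).
have D_m (n : 'I_5 -> I) : \sum_w y w * \prod_t u w (n t) =
    D (n (inord 0)) (n (inord 1)) (n (inord 2)) (n (inord 3)) (n (inord 4)).
  by apply: eq_bigr => w _; rewrite prod_ord5.
rewrite D_m.
have i0 : inord 0 = ord0 :> 'I_5 by apply: val_inj; rewrite /= inordK.
have i1 : inord 1 = lift ord0 ord0 :> 'I_5 by apply: val_inj; rewrite /= inordK.
apply: (@symmetric_two_terms F I D (a (s (inord 0))) (a (s (inord 1)))
  (a (s (inord 2))) (a (s (inord 3))) (a (s (inord 4))) (g (s (inord 0)))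
  (g (s (inord 1))) (g (s (inord 2))) (g (s (inord 3))) (g (s (inord 4)))
  lam mu (e (inord 0)) (e (inord 1)) (e (inord 2)) (e (inord 3)) (e (inord 4)) p) => //.
- move=> x1 x2 x3 x4 x5.
  pose x (t : 'I_5) := nth x5 [:: x1; x2; x3; x4; x5] t.
  have <- : \sum_w y w * \prod_t u w (x ((s^-1)%g t)) = D x1 x2 x3 x4 x5.
    apply: eq_bigr => w _; rewrite (reindex_inj (@perm_inj _ s)) /=.
    under eq_bigr do rewrite permK.
    by rewrite prod_ord5 /x !inordK.
  rewrite DE; congr (_ * _ + _ * _).
    rewrite (reindex_inj (@perm_inj _ s)) /=.
    under eq_bigr do rewrite permK.
    by rewrite prod_ord5 /x !inordK.
  rewrite (reindex_inj (@perm_inj _ s)) /=.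
  under eq_bigr do rewrite permK.
  by rewrite prod_ord5 /x !inordK.
- by move=> *; apply: eq_bigr => w _; ring.
- by move=> *; apply: eq_bigr => w _; ring.
- by rewrite -D_m.
- by rewrite i0 i1 s0 s1.
Qed.

(** With one more point than directions, an injective [s] can miss a point [y], so a single value of
    [s] can be moved to [y]; comparing the two equal nonzero products shows that each factor is
    constant. *)
Lemma constant_of_prod (F : fieldType) n (g : 'I_n.+1 -> 'I_n.+2 -> F) (c lam : F) :
  c != 0 ->
  (forall s : 'I_n.+1 -> 'I_n.+2, injective s -> lam * \prod_d g d (s d) = c) ->
  [/\ forall d x y, g d x = g d y, forall d x, g d x != 0 &
      lam * \prod_d g d ord0 = c].
Proof.
move=> c0 gE.
have place d x y : x != y -> exists2 s : 'I_n.+1 -> 'I_n.+2, injective s &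
    s d = x /\ forall d', s d' != y.
  rewrite eq_sym => /unlift_some[x' x'E _].
  exists (fun d' => lift y (tperm d x' d')).
    by move=> d1 d2 /lift_inj/perm_inj.
  by rewrite tpermL x'E; split=> // d'; rewrite eq_sym neq_lift.
have g0 d x : g d x != 0.
  have [y xy] : exists y, x != y.
    by case: (eqVneq x ord0) => [->|]; [exists ord_max | exists ord0].
  have [s injs [sd _]] := place d x y xy.
  apply: contraNneq c0 => gdx; rewrite -(gE s injs) (bigD1 d) //= sd gdx.
  by rewrite mul0r mulr0.
have gc d x y : g d x = g d y.
  have [->//|xy] := eqVneq x y; have [s injs [sd sy]] := place d x y xy.
  pose s' d' := if d' == d then y else s d'.
  have injs' : injective s'.
    move=> d1 d2; rewrite /s'; case: eqP => [->|_]; case: eqP => [->|_] //.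
    - by move/esym/eqP; rewrite (negbTE (sy _)).
    - by move/eqP; rewrite (negbTE (sy _)).
    - exact: injs.
  have := gE s injs; rewrite -(gE s' injs') (bigD1 d) //= [in RHS](bigD1 d) //=.
  rewrite sd {1}/s' eqxx.
  have -> : \prod_(d' | d' != d) g d' (s' d') = \prod_(d' | d' != d) g d' (s d').
    by apply: eq_bigr => d' /negbTE dd'; rewrite /s' dd'.
  have lam0 : lam != 0.
    by apply: contraNneq c0 => lam0; rewrite -(gE s injs) lam0 mul0r.
  move/(mulfI lam0); apply: mulIf.
  by apply/prodf_neq0 => d' _.
split=> //; rewrite -(gE (lift ord0) (@lift_inj _ _)); congr (_ * _).
by apply: eq_bigr => d _; apply: gc.
Qed.

(** * Rank bounds from seven positions on each side *)

Section LowerBounds.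
Variables (R : realType) (I W : finType) (X Y : I -> R) (u : W -> I -> R).
Variables (e e' : 'I_7 -> I).
Hypothesis indep : independent5 u.
Hypothesis Xe : forall x, X (e x) = 1.
Hypothesis Ye : forall x, Y (e x) = 0.
Hypothesis Xe' : forall x, X (e' x) = 0.
Hypothesis Ye' : forall x, Y (e' x) = 1.
Hypothesis ue : forall (s : 'I_5 -> 'I_7) w, injective s -> \prod_t u w (e (s t)) = 0.
Hypothesis ue' : forall (s : 'I_5 -> 'I_7) w, injective s -> \prod_t u w (e' (s t)) = 0.

Section Entries.
Variables (r : nat) (lam : 'I_r -> R) (v : 'I_r -> 'I_6 -> I + W -> R).
Hypothesis decomp : forall k : {ffun 'I_6 -> I + W},
  adjoined X Y u k = \sum_j lam j * \prod_i v j i (k i).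
Variables (f : 'I_6 -> 'I_#|W| -> 'I_r) (z : 'I_6 -> W -> 'I_#|W| -> R).
Hypothesis sel : forall d, selects v f z d.

Lemma reduced_entry_e (s : 'I_6 -> 'I_7) : injective s ->
  \sum_(j | ~~ selected f j) lam j * \prod_i reduced v f z i j (e (s i)) = 1.
Proof.
move=> injs; rewrite -(reduced_entry decomp sel) => [|j w].
  rewrite big1 => [|i _]; last exact: Xe.
  by rewrite (bigD1 ord0) //= Ye mul0r mulr0 subr0.
by rewrite prod_lift; apply: ue => t t' /injs/lift_inj.
Qed.

Lemma reduced_entry_e' (s : 'I_6 -> 'I_7) : injective s ->
  \sum_(j | ~~ selected f j) lam j * \prod_i reduced v f z i j (e' (s i)) = - 3.
Proof.
move=> injs; rewrite -(reduced_entry decomp sel) => [|j w].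
  rewrite (bigD1 ord0) //= Xe' mul0r sub0r big1 ?mulr1 // => i _; exact: Ye'.
by rewrite prod_lift; apply: ue' => t t' /injs/lift_inj.
Qed.

Lemma exists_unselected : exists j, ~~ selected f j.
Proof.
apply/existsP; apply: contraT; rewrite negb_exists => /forallP nsel.
have := reduced_entry_e (@lift_inj _ ord0).
rewrite big_pred0 => [/esym/eqP|j]; first by rewrite oner_eq0.
exact/negbTE/nsel.
Qed.

End Entries.

(** The selected terms number [6 * #|W|], and one more exists because an entry equal to 1 is a sum
    over unselected terms. *)
Lemma adjoined_rank_lower r (lam : 'I_r -> R) (v : 'I_r -> 'I_6 -> I + W -> R) :
  (forall k : {ffun 'I_6 -> I + W},
    adjoined X Y u k = \sum_j lam j * \prod_i v j i (k i)) ->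
  (6 * #|W| < r)%N.
Proof.
move=> decomp; have [f [z [injf sel]]] := selection indep decomp.
have [j nj] := exists_unselected decomp sel.
rewrite -(card_selected injf) -[r in (_ < r)%N]card_ord; apply: proper_card.
by apply/properP; split; [apply/subsetP | exists j => //; rewrite inE].
Qed.

Lemma adjoined_sym_rank_lower r (lam : 'I_r -> R) (v : 'I_r -> I + W -> R) :
  (forall k : {ffun 'I_6 -> I + W},
    adjoined X Y u k = \sum_j lam j * \prod_i v j (k i)) ->
  (6 * #|W| + 1 < r)%N.
Proof.
move=> decomp; have decomp' := decomp.
have [f [z [injf sel]]] := @selection _ _ _ _ _ _ _ _ (fun j _ => v j) indep decomp.
have lt_r := @adjoined_rank_lower _ _ (fun j _ => v j) decomp.
rewrite addn1 ltn_neqAle lt_r andbT; apply/eqP => rE.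
have [j0 nj0] := @exists_unselected _ _ (fun j _ => v j) decomp _ _ sel.
(* With [6 * #|W| + 1] terms, counting leaves a single unselected one. *)
have only j : ~~ selected f j = (j == j0).
  have : #|[predC [pred j | selected f j]]| = 1%N.
    apply/eqP; rewrite -(eqn_add2l #|[pred j | selected f j]|) cardC card_ord.
    by rewrite (card_selected injf) addn1 rE.
  case/mem_card1 => j1 E.
  have E1 k : ~~ selected f k = (k == j1).
    by have := E k; rewrite !inE.
  by rewrite E1; move: nj0; rewrite E1 => /eqP ->.
pose g d := reduced (fun j _ => v j) f z d j0.
have ge (s : 'I_6 -> 'I_7) : injective s -> lam j0 * \prod_d g d (e (s d)) = 1.
  move=> injs; apply: etrans (@reduced_entry_e _ _ _ decomp _ _ sel s injs).
  by rewrite [RHS](big_pred1 j0) // => j; apply: only.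
have ge' (s : 'I_6 -> 'I_7) : injective s -> lam j0 * \prod_d g d (e' (s d)) = -3.
  move=> injs; rewrite -(@reduced_entry_e' _ _ _ decomp _ _ sel s injs).
  by rewrite [RHS](big_pred1 j0) // => j; apply: only.
have [ce e0 pe] := constant_of_prod (g := fun d x => g d (e x)) (oner_neq0 _) ge.
have n3 : - 3 != 0 :> R by rewrite oppr_eq0 pnatr_eq0.
have [ce' e'0 pe'] := constant_of_prod (g := fun d x => g d (e' x)) n3 ge'.
(* If all factors have the same ratio between the two blocks, its sixth power is -3, which is
   impossible over the reals. *)
have [/forallP prop|] := boolP [forall a, [forall b,
    g a (e ord0) * g b (e' ord0) == g a (e' ord0) * g b (e ord0)]].
  pose rho := g ord0 (e' ord0) / g ord0 (e ord0).
  have rhoE d : g d (e' ord0) = rho * g d (e ord0).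
    have /eqP E := forallP (prop ord0) d.
    by rewrite /rho mulrAC -E mulrAC mulfV ?mul1r.
  have : rho ^+ 6 = - 3.
    rewrite -pe' (eq_bigr (fun d => rho * g d (e ord0))) // big_split /=.
    by rewrite prodr_const card_ord mulrCA pe mulr1.
  by have := exprn_even_ge0 (n := 6) rho isT => /[swap] ->; lra.
rewrite negb_forall => /existsP[a]; rewrite negb_forall => /existsP[b] nprop.
have ab : a != b by apply: contraNneq nprop => ->; rewrite mulrC.
have [i [ia ib]] : exists i, i != a /\ i != b.
  suff /existsP[i /andP[]] : [exists i, (i != a) && (i != b)] by exists i.
  apply: contraT; rewrite negb_exists => /forallP H.
  have : (#|'I_6| <= #|[set a; b]|)%N.
    apply: subset_leq_card; apply/subsetP => i _.
    by have := H i; rewrite !inE negb_and !negbK.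
  by rewrite cards2 card_ord ab.
have [ta taE _] := unlift_some ia; have [tb tbE _] := unlift_some ib.
(* This is the coordinate of the left-over vector on the [l]-th selected one. Were it nonzero, the
   dual slice would be a combination of fifth powers with two rank one terms, hence 0, and
   independence would force [z i ^~ l] to vanish, against duality. *)
have kappa l : \sum_w z i w l * v j0 (inr w) = 0.
  set mu := \sum_w _; apply/eqP; apply: contraT => mu0.
  suff y0 w : z i w l = 0.
    have := proj1 (sel i) l l; rewrite eqxx big1 => [/esym/eqP|w _].
      by rewrite oner_eq0.
    by rewrite y0 mul0r.
  move: w; apply: indep.
  apply: (@power_sum_two_terms _ _ _ u (z i ^~ l)
    (fun t => reduced (fun j _ => v j) f z (lift i t) (f i l))
    (fun t => g (lift i t)) (lam (f i l)) (mu * lam j0)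
    (fun t => e (lift ord0 (lift ord0 t))) (e' ord0) ta tb).
  - move=> m; pose k (d : 'I_6) := if unlift i d is Some t then m t else m ord0.
    have kE t : k (lift i t) = m t by rewrite /k liftK.
    have := @dual_slice _ _ _ _ _ _ _ _ (fun j _ => v j) decomp f z i l k injf sel.
    rewrite [X in _ = _ + X](big_pred1 j0) /= -/mu; last by move=> j; apply: only.
    have -> : \sum_w z i w l * \prod_(d < 6 | d != i) u w (k d) =
              \sum_w z i w l * \prod_t u w (m t).
      apply: eq_bigr => w _; rewrite prod_lift; congr (_ * _).
      by apply: eq_bigr => t _; rewrite kE.
    move=> ->; rewrite !prod_lift mulrA; congr (_ * _ + _ * _).
      by apply: eq_bigr => t _; rewrite kE.
    by apply: eq_bigr => t _; rewrite kE.
  - by apply: big1 => w _; rewrite ue ?mulr0 // => t t' /lift_inj/lift_inj.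
  - by move=> t t'; apply: e0.
  - rewrite mulf_neq0 //; apply: contra_eq_neq pe => ->.
    by rewrite mul0r eq_sym oner_neq0.
  - by apply: contraNneq ab => tab; rewrite taE tbE tab.
  - rewrite -taE -tbE.
    by rewrite (ce a _ ord0) (ce b _ ord0).
(* The new components of [v j0] are recovered from their coordinates in the selected basis, all 0 by
   [kappa]. *)
have vj0 w : v j0 (inr w) = 0.
  transitivity (\sum_w' (w' == w)%:R * v j0 (inr w')).
    rewrite (bigD1 w) //= eqxx mul1r big1 ?addr0 // => w' /negbTE ->.
    by rewrite mul0r.
  under eq_bigr => w' _ do rewrite -(proj2 (sel i)) mulr_suml.
  rewrite exchange_big big1 //= => l _.
  under eq_bigr do rewrite mulrAC.
  by rewrite -mulr_suml kappa mul0r.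
(* Without new components the projection changes nothing, so the six factors coincide, contradicting
   [nprop]. *)
have gab d p : g d p = v j0 (inl p).
  rewrite /g /reduced /pairing dot_delta big1 ?addr0 //= => w _.
  by rewrite vj0 mulr0.
by move: nprop; rewrite !gab mulrC eqxx.
Qed.

End LowerBounds.

(** * Upper bounds *)

Definition pol_node (R : realType) (q : nat) : R :=
  nth 0 [:: 1; -1; 2; -2; 3; -3] q.

(** Weights whose moments at the nodes are 1 in degree 1 and 0 in the other degrees up to 6; being
    odd in the node, they kill the even degrees. *)
Definition pol_weight (R : realType) (q : nat) : R :=
  nth 0 [:: 3/4; -3/4; -3/20; 3/20; 1/60; -1/60] q.

(* [6 x^5 y] is a combination of the sixth powers of [x + a y] for six real nodes
   [a] as soon as the product of the [t - a] has no term of degree 1 in [t]. *)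
Lemma polarization_nat (R : realType) (x y : nat -> R) :
  \sum_(j < 6) \prod_(i < 6) (if i == j :> nat then y i else x i) =
  \sum_(q < 6) pol_weight R q * \prod_(i < 6) (x i + pol_node R q * y i).
Proof.
rewrite !big_ord_recr !big_ord0 /= /pol_weight /pol_node /=.
by field.
Qed.

Lemma polarization (R : realType) (x y : 'I_6 -> R) :
  \sum_j \prod_i (if i == j then y i else x i) =
  \sum_(q < 6) pol_weight R q * \prod_i (x i + pol_node R q * y i).
Proof.
have E := polarization_nat (fun i => x (inord i)) (fun i => y (inord i)).
transitivity (\sum_(j < 6) \prod_(i < 6)
    (if i == j :> nat then y (inord i) else x (inord i))).
  by apply: eq_bigr => j _; apply: eq_bigr => i _; rewrite !inord_val.
rewrite E; apply: eq_bigr => q _; congr (_ * _).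
by apply: eq_bigr => i _; rewrite !inord_val.
Qed.

(** Entries depend only on the blocks of the indices, so 64 cases suffice. Expanding
    [(X + Y)^5 (X - 3 Y)] leaves [3 X^5 Y - Y^5 X] with the odd factor last; the sum over [j] of
    [h j 1 * X j] counts each monomial with one [Y] five times, and likewise for [h j 4 * Y j],
    whence the divisions by 5. *)
Lemma correction_bool (R : realType) (b : nat -> bool) :
  let n := (\sum_(i < 6) ~~ b i)%N in
  let h j s : R := ((n - ~~ b j)%N == s)%:R in
  let X i : R := (b i)%:R in
  let Y i : R := (~~ b i)%:R in
  \prod_(i < 6) X i - 3 * \prod_(i < 6) Y i =
  \prod_(i < 6) (if i == 5 :> nat then X i - 3 * Y i else X i + Y i) +
  \sum_(j < 6) (3 / 5 * h j 1%N * X j - h j 4%N / 5 * Y j +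
    (j == 5 :> nat)%:R * (- (h j 1%N + h j 2%N + h j 3%N + h j 4%N) *
      (X j - 3 * Y j) - 3 * h j 1%N * X j + h j 4%N * Y j)).
Proof.
move=> n h X Y; rewrite /h /X /Y /n => {h X Y n}.
repeat rewrite big_ord_recr; rewrite !big_ord0 /=.
case: (b 0); case: (b 1%N); case: (b 2%N); case: (b 3%N); case: (b 4%N); case: (b 5%N);
repeat match goal with |- context [@eq_op ?T ?m ?n] =>
  let c := eval vm_compute in (@eq_op T m n) in change (@eq_op T m n) with c end;
rewrite /=.
all: try by field.
Qed.

Section Upper.
Variables (R : realType) (I W : finType) (side : I -> bool) (u : W -> I -> R).

Let X p : R := (side p)%:R.
Let Y p : R := (~~ side p)%:R.

(** Polarization turns the six slices of each [w] into six sixth powers; [X^6] and [- 3 Y^6] are the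
    two extra terms. *)
Lemma adjoined_sym_rank_upper : exists (lam : 'I_(6 * #|W| + 2) -> R)
    (v : 'I_(6 * #|W| + 2) -> I + W -> R),
  forall k : 'I_6 -> I + W, adjoined X Y u k = \sum_j lam j * \prod_i v j (k i).
Proof.
pose T : finType := ('I_6 * W + bool)%type.
have cT : #|T| = (6 * #|W| + 2)%N by rewrite card_sum card_prod card_ord card_bool.
pose lam (t : T) : R := match t with
  | inl qw => pol_weight R qw.1 | inr true => 1 | inr false => - 3 end.
pose v (t : T) : I + W -> R := match t with
  | inl qw => fun c => sum_fun (u qw.2) (fun=> 0) c +
      pol_node R qw.1 * sum_fun (fun=> 0) (fun w' => (w' == qw.2)%:R) c
  | inr true => sum_fun X (fun=> 0) | inr false => sum_fun Y (fun=> 0) end.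
rewrite -cT; exists (lam \o enum_val), (v \o enum_val) => k.
rewrite -(big_enum_val (A := T) (fun t => lam t * \prod_i v t (k i))) /=.
rewrite big_sumType /= big_bool /= mul1r mulNr addrC; congr (_ + _).
rewrite -(pair_big predT predT (fun (q : 'I_6) w => pol_weight R q * \prod_i
  (sum_fun (u w) (fun=> 0) (k i) +
   pol_node R q * sum_fun (fun=> 0) (fun w' => (w' == w)%:R) (k i)))) /=.
rewrite [LHS]exchange_big [RHS]exchange_big /=; apply: eq_bigr => w _.
rewrite -polarization; apply: eq_bigr => j _; apply: eq_bigr => i _.
by case: ifP.
Qed.

Definition opp_count n (k : 'I_n -> I) := (\sum_i ~~ side (k i))%N.

Lemma opp_count_lift (k : 'I_6 -> I) j :
  opp_count (fun t => k (lift j t)) = (opp_count k - ~~ side (k j))%N.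
Proof. by rewrite /opp_count (bigD1_ord j) //= addKn. Qed.

Definition sym_combination s (c : W -> R) := forall m : 'I_5 -> I,
  \sum_w c w * \prod_t u w (m t) = (opp_count m == s)%:R.

(* [sym_combination s] says that the symmetrised product of [5 - s] copies of [X] and
   [s] copies of [Y] is in the span of the [u w ^ 5].  The cases [s = 1] and [s = 4],
   tensored with [X], resp. [Y], in each direction, also yield [X^5 Y] and [X Y^5]
   with the odd factor in the last direction. *)
Lemma correction (c : nat -> W -> R) :
  (forall s, (0 < s < 5)%N -> sym_combination s (c s)) ->
  exists g : 'I_6 -> W -> I -> R, forall k : 'I_6 -> I,
    \prod_i X (k i) - 3 * \prod_i Y (k i) =
    \prod_i (if i == ord_max then X (k i) - 3 * Y (k i) else X (k i) + Y (k i)) +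
    \sum_j \sum_w \prod_i (if i == j then g j w else u w) (k i).
Proof.
move=> cE.
exists (fun j w p => 3 / 5 * c 1%N w * X p - c 4%N w / 5 * Y p +
  (j == ord_max)%:R * (- (c 1%N w + c 2%N w + c 3%N w + c 4%N w) * (X p - 3 * Y p)
    - 3 * c 1%N w * X p + c 4%N w * Y p)) => k.
pose h j s : R := (opp_count (fun t => k (lift j t)) == s)%:R.
have hE (j : 'I_6) s : (0 < s < 5)%N -> \sum_w c s w * \prod_(t < 5) u w (k (lift j t)) = h j s.
  by move=> s5; rewrite cE.
pose d (j : 'I_6) : R := (j == ord_max)%:R.
have sumE (j : 'I_6) : \sum_w \prod_i (if i == j then (fun p => 3 / 5 * c 1%N w * X p
    - c 4%N w / 5 * Y p + d j * (- (c 1%N w + c 2%N w + c 3%N w + c 4%N w) *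
    (X p - 3 * Y p) - 3 * c 1%N w * X p + c 4%N w * Y p)) else u w) (k i) =
  3 / 5 * h j 1%N * X (k j) - h j 4%N / 5 * Y (k j) +
    d j * (- (h j 1%N + h j 2%N + h j 3%N + h j 4%N) *
      (X (k j) - 3 * Y (k j)) - 3 * h j 1%N * X (k j) + h j 4%N * Y (k j)).
  pose B := - d j * (X (k j) - 3 * Y (k j)).
  pose P w := \prod_(t < 5) u w (k (lift j t)).
  transitivity (\sum_w ((3 / 5 * X (k j) + B - 3 * d j * X (k j)) * (c 1%N w * P w)
    + B * (c 2%N w * P w) + B * (c 3%N w * P w) +
    (- Y (k j) / 5 + B + d j * Y (k j)) * (c 4%N w * P w))).
    apply: eq_bigr => w _; rewrite (bigD1 j) //= eqxx.
    rewrite [X in _ * X = _](_ : _ = P w); first by rewrite /B; field.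
    rewrite prod_lift; apply: eq_bigr => t _.
    by rewrite eq_sym (negbTE (neq_lift j t)).
  by rewrite !big_split /= -!mulr_sumr !hE // /B; field.
rewrite [X in _ = _ + X](eq_bigr _ (fun j _ => sumE j)); clear sumE.
pose b n := side (k (inord n)).
have kb i : side (k i) = b i by rewrite /b inord_val.
have nE : opp_count k = (\sum_(i < 6) ~~ b i)%N.
  by apply: eq_bigr => i _; rewrite kb.
apply: etrans (etrans (correction_bool R b) _).
  by congr (_ - 3 * _); apply: eq_bigr => i _; rewrite /X /Y kb.
congr (_ + _); apply: eq_bigr => i _; rewrite /X /Y kb //.
by rewrite /h /d !opp_count_lift nE kb.
Qed.

(** The corrections [g j w] cost no extra term: they are added to the new unit vector in direction
    [j], next to the same five factors [u w]. *)
Lemma adjoined_rank_upper (c : nat -> W -> R) :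
  (forall s, (0 < s < 5)%N -> sym_combination s (c s)) ->
  exists v : 'I_(6 * #|W| + 1) -> 'I_6 -> I + W -> R,
  forall k : 'I_6 -> I + W, adjoined X Y u k = \sum_j \prod_i v j i (k i).
Proof.
move=> /correction[g gE].
pose T : finType := ('I_6 * W + unit)%type.
have cT : #|T| = (6 * #|W| + 1)%N by rewrite card_sum card_prod card_ord card_unit.
pose v (t : T) (i : 'I_6) : I + W -> R := match t with
  | inl jw => if i == jw.1 then sum_fun (g jw.1 jw.2) (fun w' => (w' == jw.2)%:R)
              else sum_fun (u jw.2) (fun=> 0)
  | inr _ => sum_fun (fun p => if i == ord_max then X p - 3 * Y p else X p + Y p)
              (fun=> 0) end.
rewrite -cT; exists (v \o enum_val) => k.
rewrite -(big_enum_val (A := T) (fun t => \prod_i v t i (k i))) /=.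
rewrite big_sumType /= [X in _ = _ + X](big_pred1 tt) /=; last by case.
rewrite -(pair_big predT predT (fun (j : 'I_6) w => \prod_i
  (if i == j then sum_fun (g j w) (fun w' => (w' == w)%:R)
   else sum_fun (u w) (fun=> 0)) (k i))) /=.
have split j w : \prod_i (if i == j then sum_fun (g j w) (fun w' => (w' == w)%:R)
   else sum_fun (u w) (fun=> 0)) (k i) =
  \prod_i (if i == j then sum_fun (fun=> 0) (fun w' => (w' == w)%:R)
   else sum_fun (u w) (fun=> 0)) (k i) +
  \prod_i sum_fun (if i == j then g j w else u w) (fun=> 0) (k i).
  rewrite (bigD1 j) //= [X in _ = X + _](bigD1 j) //= [X in _ = _ + X](bigD1 j) //=.
  rewrite !eqxx [X in _ = _ + _ * X](_ : _ =
    \prod_(i | i != j) (if i == j then sum_fun (fun=> 0) (fun w' => (w' == w)%:R)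
   else sum_fun (u w) (fun=> 0)) (k i)); last first.
    by apply: eq_bigr => i /negbTE ->.
  rewrite [in LHS](_ : \prod_(i | i != j) _ =
    \prod_(i | i != j) (if i == j then sum_fun (fun=> 0) (fun w' => (w' == w)%:R)
   else sum_fun (u w) (fun=> 0)) (k i)); last first.
    by apply: eq_bigr => i /negbTE ->.
  by rewrite -mulrDl; congr (_ * _); case: (k j) => c' /=; rewrite ?add0r ?addr0.
under [X in _ = X + _]eq_bigr do under eq_bigr do rewrite split.
under [X in _ = X + _]eq_bigr do rewrite big_split.
rewrite big_split /= -addrA addrC /adjoined; congr (_ + _).
(* At an adjoined index every purely old product vanishes; otherwise the identity is that of
   [correction]. *)
have [/existsP[i ki]|] := boolP [exists i, if k i is inr _ then true else false].
  have z (x : 'I_6 -> I -> R) : \prod_i sum_fun (x i) (fun=> 0) (k i) = 0.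
    by rewrite (bigD1 i) //=; case: (k i) ki => //= w _; rewrite mul0r.
  rewrite !z mulr0 subrr addr0 big1 // => j _; apply: big1 => w _; exact: z.
rewrite negb_exists => /forallP kI.
have /fin_all_exists[k' k'E] i : exists p, k i = inl p.
  by case: (k i) (kI i) => [p _|//]; exists p.
have zE (x : 'I_6 -> I -> R) :
    \prod_i sum_fun (x i) (fun=> 0) (k i) = \prod_i x i (k' i).
  by apply: eq_bigr => i _; rewrite k'E.
rewrite !zE gE addrC; congr (_ + _).
by apply: eq_bigr => j _; apply: eq_bigr => w _; rewrite zE.
Qed.
End Upper.

(** * The sixteen types of vectors *)

(* The 16 types of [Ulist] for [n = 7]: the number of [alpha]s on each side and
   the coefficient of the second block. *)
Definition type_a (t : nat) : nat :=
  nth 0%N [:: 4; 3; 2; 1; 4; 2; 1; 1; 3; 2; 2; 0; 3; 3; 1; 0]%N t.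

Definition type_b (t : nat) : nat :=
  nth 0%N [:: 0; 0; 0; 0; 1; 1; 1; 1; 2; 2; 1; 1; 1; 1; 2; 2]%N t.

Section Types.
Variable R : realType.

Definition type_c (t : nat) : R :=
  nth 0 [:: 1; 1; 1; 1; 1; 25/24; 5/4; 2; 1; 5/4; 5/3; 1; 4/3; 5/6; 3/2; 1] t.

Lemma type_c_neq0 t : (t < 16)%N -> type_c t != 0.
Proof.
rewrite /type_c.
do 16 (case: t => [_ /=|t]; first by rewrite ?mulf_neq0 ?invr_neq0 ?pnatr_eq0 ?oner_neq0).
by [].
Qed.

(* The value of a vector of type [t] on the pair of coordinates number [x] of the
   first ([s = true]) or second block. *)
Definition type_val t (A B : {set 'I_7}) (s : bool) (x : 'I_7) : R :=
  if s then (x \in A)%:R else type_c t * (x \in B)%:R.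

Definition type_sum (f : nat -> {set 'I_7} -> {set 'I_7} -> R)
    (s : 'I_5 -> bool) (x : 'I_5 -> 'I_7) : R :=
  \sum_(t < 16) \sum_(A : {set 'I_7} | #|A| == type_a t)
    \sum_(B : {set 'I_7} | #|B| == type_b t)
      f t A B * \prod_i type_val t A B (s i) (x i).

Definition up_sum (f : nat -> {set 'I_7} -> {set 'I_7} -> R) t (S T : {set 'I_7}) : R :=
  \sum_(A : {set 'I_7} | #|A| == type_a t)
    \sum_(B : {set 'I_7} | #|B| == type_b t)
      f t A B * ((S \subset A) && (T \subset B))%:R.

(** A factor is 0 unless its pair lies in [A] or [B] respectively, so an entry sees only the sets of
    pairs met in the two blocks and the number of indices in the second. *)
Lemma prod_type_val t A B (s : 'I_5 -> bool) (x : 'I_5 -> 'I_7) :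
  \prod_i type_val t A B (s i) (x i) = type_c t ^+ #|[pred i | ~~ s i]| *
    ((x @: [set i | s i] \subset A) && (x @: [set i | ~~ s i] \subset B))%:R.
Proof.
have [/andP[/subsetP SA /subsetP TB]|] := boolP (_ && _).
  rewrite mulr1 -prodr_const [RHS]big_mkcond /=; apply: eq_bigr => i _.
  rewrite /type_val inE; case: (boolP (s i)) => si /=.
    by rewrite SA //; apply: imset_f; rewrite inE.
  by rewrite TB ?mulr1 //; apply: imset_f; rewrite inE.
rewrite mulr0 negb_and => /orP[] /subsetPn[y /imsetP[i]]; rewrite inE => si -> xi.
  by rewrite (bigD1 i) //= /type_val si (negbTE xi) mul0r.
by rewrite (bigD1 i) //= /type_val (negbTE si) (negbTE xi) mulr0 mul0r.
Qed.

Lemma type_sumE f (s : 'I_5 -> bool) (x : 'I_5 -> 'I_7) :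
  type_sum f s x = \sum_(t < 16) type_c t ^+ #|[pred i | ~~ s i]| *
    up_sum f t (x @: [set i | s i]) (x @: [set i | ~~ s i]).
Proof.
apply: eq_bigr => t _; rewrite mulr_sumr; apply: eq_bigr => A _.
rewrite mulr_sumr; apply: eq_bigr => B _.
by rewrite prod_type_val mulrCA.
Qed.

(** Triples realised by five indices: [q] of them in the second block, meeting [a] pairs of the
    first block and [b] of the second; see [realize] and [admissible_images]. *)
Definition admissible (q a b : nat) : bool :=
  [&& q <= 5, a <= 5 - q, b <= q, (0 < a) || (q == 5) & (0 < b) || (q == 0)]%N.

Lemma onto_set m (S : {set 'I_7}) : (#|S| <= m)%N -> (0 < #|S|)%N || (m == 0)%N ->
  exists x : nat -> 'I_7, forall y, y \in S <-> exists2 i, (i < m)%N & y = x i.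
Proof.
move=> Sm /orP[/card_gt0P[x0 x0S]|/eqP m0].
  exists (fun i => nth x0 (enum S) i) => y; split=> [yS|[i im ->]].
    exists (index y (enum S)); last by rewrite nth_index // mem_enum.
    by apply: leq_trans Sm; rewrite cardE index_mem mem_enum.
  have [iS|iS] := ltnP i (size (enum S)); last by rewrite nth_default.
  by rewrite -mem_enum mem_nth.
exists (fun=> ord0) => y; split=> [yS|[i]]; last by rewrite m0.
by move: Sm; rewrite m0 leqn0 cards_eq0 => /eqP S0; move: yS; rewrite S0 inE.
Qed.

Lemma realize q (S T : {set 'I_7}) : admissible q #|S| #|T| ->
  exists (s : 'I_5 -> bool) (x : 'I_5 -> 'I_7),
    [/\ #|[pred i | ~~ s i]| = q, x @: [set i | s i] = S &
        x @: [set i | ~~ s i] = T].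
Proof.
case/and5P => q5 Sq Tq S0 T0.
have [|xS xSP] := onto_set Sq.
  by case/orP: S0 => [->//|/eqP ->]; rewrite orbT.
have [xT xTP] := onto_set Tq T0.
exists (fun i => (q <= i)%N), (fun i => if (q <= i)%N then xS (i - q)%N else xT i).
split.
- have inj : injective (widen_ord q5) by move=> i j [ij]; apply: val_inj.
  rewrite -[RHS](card_ord q) -(card_imset _ inj).
  apply: eq_card => i; rewrite !inE -ltnNge; apply/idP/imsetP => [iq|[j _ ->]].
    by exists (Ordinal iq) => //; apply: val_inj.
  by rewrite /= ltn_ord.
- apply/setP => y; apply/imsetP/idP => [[i]|/xSP[i iq ->]].
    rewrite inE => qi ->; rewrite qi; apply/xSP; exists (i - q)%N => //.
    by have := ltn_ord i; lia.
  have i5 : (i + q < 5)%N by lia.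
  by exists (Ordinal i5); rewrite ?inE /= ?leq_addl // addnK.
- apply/setP => y; apply/imsetP/idP => [[i]|/xTP[i iq ->]].
    by rewrite inE => /negbTE qi ->; rewrite qi; apply/xTP; exists i => //; lia.
  have i5 : (i < 5)%N by lia.
  by exists (Ordinal i5); rewrite ?inE /= leqNgt iq.
Qed.

(** * Independence of the fifth powers of the sixteen types *)

Section SingleIndependence.
Variable f : nat -> {set 'I_7} -> {set 'I_7} -> R.
Hypothesis f0 : forall s x, type_sum f s x = 0.

Definition vanishes t := forall A B : {set 'I_7},
  #|A| = type_a t -> #|B| = type_b t -> f t A B = 0.

(* Evaluated on supports of sizes [a] and [b], only the types [live] of exactly
   these sizes survive: smaller ones miss the supports, and the larger ones,
   listed in [dn], are already known to vanish. *)
Lemma surviving_types (dn live : seq nat) q a b (A B : {set 'I_7}) :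
  (forall t, t \in dn -> vanishes t) ->
  all (fun t => [|| t \in live, t \in dn, type_a t < a | type_b t < b]%N) (iota 0 16) ->
  all (fun t => [&& t < 16, type_a t == a & type_b t == b]%N) live -> uniq live ->
  admissible q a b -> #|A| = a -> #|B| = b ->
  \sum_(t <- live) type_c t ^+ q * f t A B = 0.
Proof.
move=> dn0 /allP cover /allP liveP ulive adm cA cB.
have [|s [x [<- SA TB]]] := @realize q A B; first by rewrite cA cB.
rewrite -[RHS](f0 s x) type_sumE SA TB.
rewrite -(big_mkord predT (fun t => type_c t ^+ #|[pred i | ~~ s i]| * up_sum f t A B)).
rewrite [RHS](bigID (mem live)) /= [X in _ = _ + X]big1_seq ?addr0.
  rewrite -[RHS]big_filter.
  have pl : perm_eq [seq t <- index_iota 0 16 | t \in live] live.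
    apply: uniq_perm => //; first by rewrite filter_uniq ?iota_uniq.
    move=> t; rewrite mem_filter mem_index_iota andbC /=.
    by case: (boolP (t \in live)) => [/liveP/and3P[-> _ _]|]; rewrite ?andbF.
  rewrite (perm_big _ pl) /=.
  rewrite !big_seq; apply: eq_bigr => t /liveP/and3P[_ /eqP ta /eqP tb].
  congr (_ * _); rewrite /up_sum (bigD1 A) /= ?cA ?ta // [X in _ = _ + X]big1.
    rewrite addr0 (bigD1 B) /= ?cB ?tb // [X in _ = _ + X]big1.
      by rewrite addr0 !subxx mulr1.
    move=> B' /andP[/eqP cB' nB]; case: (boolP (B \subset B')) => [sB|].
      by move: nB; rewrite eq_sym; have := eqEcard B B'; rewrite sB cB cB' leqnn => ->.
    by rewrite andbF mulr0.
  move=> A' /andP[/eqP cA' nA]; case: (boolP (A \subset A')) => [sA|_].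
    by move: nA; rewrite eq_sym; have := eqEcard A A'; rewrite sA cA cA' leqnn => ->.
  by rewrite big1 // => B' _; rewrite mulr0.
move=> t /andP[nlive /cover]; rewrite (negbTE nlive) /= => tP.
rewrite [X in _ * X]big1 ?mulr0 // => A' /eqP cA'; rewrite big1 // => B' /eqP cB'.
case/or3P: tP => [/dn0 -> //|ta|tb]; first by rewrite mul0r.
  case: (boolP (A \subset A')) => [/subset_leq_card|_]; last by rewrite mulr0.
  by rewrite cA cA' leqNgt ta.
case: (boolP (B \subset B')) => [/subset_leq_card|_]; last by rewrite andbF mulr0.
by rewrite cB cB' leqNgt tb.
Qed.

Lemma vanishing_step1 (dn : seq nat) t q :
  (forall t', t' \in dn -> vanishes t') ->
  [&& all (fun t' => [|| t' == t, t' \in dn, type_a t' < type_a t |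
    type_b t' < type_b t]%N) (iota 0 16), (t < 16)%N &
    admissible q (type_a t) (type_b t)] ->
  forall t', t' \in t :: dn -> vanishes t'.
Proof.
move=> dn0 /and3P[cover t16 adm] t'; rewrite inE => /orP[/eqP ->|/dn0 //] A B cA cB.
have := @surviving_types dn [:: t] q _ _ A B dn0 _ _ isT adm cA cB.
rewrite big_seq1 => E; have /eqP : type_c t ^+ q * f t A B = 0.
  apply: E; last by rewrite /= t16 !eqxx.
  by apply: sub_all cover => t''; rewrite mem_seq1.
by rewrite mulf_eq0 expf_eq0 (negbTE (type_c_neq0 t16)) andbF => /eqP.
Qed.

(** Two types of equal sizes are separated by their coefficients: the exponents [q] and [q.+1] give
    an invertible Vandermonde system. *)
Lemma vanishing_step2 (dn : seq nat) t1 t2 q :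
  (forall t', t' \in dn -> vanishes t') -> type_c t1 != type_c t2 ->
  [&& all (fun t' => [|| t' == t1, t' == t2, t' \in dn, type_a t' < type_a t1 |
    type_b t' < type_b t1]%N) (iota 0 16), (t1 < 16)%N, (t2 < 16)%N, t1 != t2,
    type_a t2 == type_a t1, type_b t2 == type_b t1,
    admissible q (type_a t1) (type_b t1) & admissible q.+1 (type_a t1) (type_b t1)] ->
  forall t', t' \in [:: t1, t2 & dn] -> vanishes t'.
Proof.
move=> dn0 c12 /and5P[cover t1_16 t2_16 t12 /and4P[ta tb adm adm']].
have E q' (A B : {set 'I_7}) : admissible q' (type_a t1) (type_b t1) -> #|A| = type_a t1 ->
    #|B| = type_b t1 -> type_c t1 ^+ q' * f t1 A B + type_c t2 ^+ q' * f t2 A B = 0.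
  move=> adq cA cB.
  have := @surviving_types dn [:: t1; t2] q' _ _ A B dn0 _ _ _ adq cA cB.
  rewrite big_cons big_seq1 => -> //.
  - by apply: sub_all cover => t'; rewrite !inE orbA.
  - by rewrite /= t1_16 t2_16 ta tb !eqxx.
  - by rewrite /= inE t12.
have van (A B : {set 'I_7}) : #|A| = type_a t1 -> #|B| = type_b t1 -> f t1 A B = 0 /\ f t2 A B = 0.
  move=> cA cB; have E0 := E _ _ _ adm cA cB; have E1 := E _ _ _ adm' cA cB.
  have f2 : type_c t2 ^+ q * (type_c t2 - type_c t1) * f t2 A B = 0.
    have -> : type_c t2 ^+ q * (type_c t2 - type_c t1) * f t2 A B =
      (type_c t1 ^+ q.+1 * f t1 A B + type_c t2 ^+ q.+1 * f t2 A B) -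
      type_c t1 * (type_c t1 ^+ q * f t1 A B + type_c t2 ^+ q * f t2 A B).
      by rewrite !exprS; ring.
    by rewrite E0 E1 mulr0 subrr.
  have {}f2 : f t2 A B = 0.
    move/eqP: f2; rewrite !mulf_eq0 expf_eq0 (negbTE (type_c_neq0 t2_16)) andbF.
    by rewrite subr_eq0 eq_sym (negbTE c12) => /eqP.
  split=> //; move/eqP: E0; rewrite f2 mulr0 addr0 mulf_eq0 expf_eq0.
  by rewrite (negbTE (type_c_neq0 t1_16)) andbF => /eqP.
move=> t'; rewrite !inE => /or3P[/eqP ->|/eqP ->|/dn0 //] A B cA cB.
  by case: (van A B cA cB).
by case: (van A B); rewrite ?cA ?cB ?(eqP ta) ?(eqP tb).
Qed.

(** Types are eliminated from large sizes to small, so that any other type large enough to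
    contribute is already done; the pairs 13 and 12, 5 and 10, 6 and 7 share their sizes and go
    together. *)
Lemma all_vanish t : (t < 16)%N -> vanishes t.
Proof.
have Z0 : forall t', t' \in [::] -> vanishes t' by [].
have c1 : type_c 13 != type_c 12 by rewrite lt_eqF // /type_c /=; lra.
have c2 : type_c 5 != type_c 10 by rewrite lt_eqF // /type_c /=; lra.
have c3 : type_c 6 != type_c 7 by rewrite lt_eqF // /type_c /=; lra.
have Z1 := @vanishing_step1 _ 8 2 Z0 isT.
have Z2 := @vanishing_step1 _ 4 1 Z1 isT.
have Z3 := @vanishing_step2 _ 13 12 1 Z2 c1 isT.
have Z4 := @vanishing_step1 _ 9 2 Z3 isT.
have Z5 := @vanishing_step2 _ 5 10 1 Z4 c2 isT.
have Z6 := @vanishing_step1 _ 14 2 Z5 isT.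
have Z7 := @vanishing_step2 _ 6 7 1 Z6 c3 isT.
have Z8 := @vanishing_step1 _ 15 5 Z7 isT.
have Z9 := @vanishing_step1 _ 11 5 Z8 isT.
have Z10 := @vanishing_step1 _ 0 0 Z9 isT.
have Z11 := @vanishing_step1 _ 1 0 Z10 isT.
have Z12 := @vanishing_step1 _ 2 0 Z11 isT.
have Z13 := @vanishing_step1 _ 3 0 Z12 isT.
move=> t16; apply: Z13; move: t t16.
by do 16 (case=> [//|]).
Qed.

End SingleIndependence.

(** A set [B] has at most two elements and cannot contain three distinct pairs. *)
Lemma type_sum_eq0 f (s : 'I_5 -> bool) (x : 'I_5 -> 'I_7) :
  injective x -> (2 < #|[pred i | ~~ s i]|)%N -> type_sum f s x = 0.
Proof.
move=> injx s2; rewrite type_sumE big1 // => t _.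
rewrite [X in _ * X]big1 ?mulr0 // => A _; rewrite big1 // => B /eqP cB.
case: (boolP (_ \subset B)) => [/subset_leq_card|_]; last by rewrite andbF mulr0.
rewrite card_imset // cB cardsE leqNgt => /negP[]; apply: leq_trans s2.
rewrite ltnS; case: t {cB} => t /=; do 16 (case: t => [//|t]); by [].
Qed.

(** Counting complements keeps the formula right for [a < #|S|], where [a - #|S|] would truncate to
    0 and give 1. *)
Lemma card_supersets a (S : {set 'I_7}) : (a <= 7)%N ->
  \sum_(A : {set 'I_7} | #|A| == a) (S \subset A)%:R = 'C(7 - #|S|, 7 - a)%:R :> R.
Proof.
move=> a7; have -> : (7 - #|S|)%N = #|~: S| by rewrite [RHS]cardsCs setCK card_ord.
rewrite -cards_draws -natr_sum; congr _%:R.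
rewrite -sum1_card -big_mkcondr (reindex_inj (@setC_inj _)) /=.
apply: eq_bigl => A; rewrite !inE -{1}(setCK S) setCS andbC; congr (_ && _).
rewrite [#|~: A|]cardsCs setCK card_ord.
have : (#|A| <= #|'I_7|)%N by apply: max_card.
rewrite card_ord; move: #|A| => m m7; apply/eqP/eqP; lia.
Qed.

Lemma type_sum_const (e : nat -> R) (s : 'I_5 -> bool) (x : 'I_5 -> 'I_7) :
  type_sum (fun t _ _ => e t) s x = \sum_(t < 16)
    e t * type_c t ^+ #|[pred i | ~~ s i]| *
    ('C(7 - #|x @: [set i | s i]|, 7 - type_a t) *
     'C(7 - #|x @: [set i | ~~ s i]|, 7 - type_b t))%:R.
Proof.
rewrite type_sumE; apply: eq_bigr => t _.
rewrite [in RHS](mulrC (e t)) -mulrA; congr (_ * _).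
have t7 : (type_a t <= 7)%N /\ (type_b t <= 7)%N.
  by case: t => t /= _; do 16 (case: t => [//|t]); rewrite /type_a /type_b /= !nth_nil.
rewrite natrM -card_supersets ?(proj1 t7) // -card_supersets ?(proj2 t7) //.
rewrite [X in e t * X]mulr_suml mulr_sumr; apply: eq_bigr => A _.
rewrite mulrA mulr_sumr; apply: eq_bigr => B _.
by rewrite -mulnb natrM mulrA.
Qed.

Lemma admissible_images (s : 'I_5 -> bool) (x : 'I_5 -> 'I_7) :
  admissible #|[pred i | ~~ s i]| #|x @: [set i | s i]| #|x @: [set i | ~~ s i]|.
Proof.
have sC : (#|[set i | s i]| = 5 - #|[pred i | ~~ s i]|)%N.
  have -> : #|[pred i | ~~ s i]| = #|[predC [set i | s i]]|.
    by apply: eq_card => i; rewrite !inE.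
  by have := cardC [set i | s i]; rewrite card_ord => /(canRL (addnK _)).
have pos (P : {set 'I_5}) : (0 < #|x @: P|)%N = (0 < #|P|)%N.
  by rewrite !card_gt0 imset_eq0.
have q5 : (#|[pred i | ~~ s i]| <= 5)%N by have := max_card [pred i | ~~ s i]; rewrite card_ord.
apply/and5P; split=> //.
- by rewrite -sC leq_imset_card.
- by have := leq_imset_card x [set i | ~~ s i]; rewrite [X in (_ <= X)%N]cardsE.
- by rewrite pos sC subn_gt0; case: ltngtP q5.
- by rewrite pos cardsE lt0n orbC orbN.
Qed.

(* The coefficients solve the linear system of [type_sum_const]. *)
Definition coef_X4Y (t : nat) : R :=
  nth 0 [:: -7; 63/4; -126/5; 35; 1; 0; 0; -5; 0; 0; 18/5; 5 * 7 ^+ 4 / 27; -9/4; 0; 0; 0] t.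

Definition coef_X3Y2 (t : nat) : R :=
  nth 0 [:: 0; 147/5; -9408/125; 392/3; 0; 2304/125; -32; 0; 1; -64/25; 0;
    5 ^+ 5 * 7 ^+ 3 / (2 ^+ 7 * 3 ^+ 3); 0; -36/5; 40/9; -1715/16] t.

Lemma coef_system q a b : admissible q a b ->
  \sum_(t < 16) coef_X4Y t * type_c t ^+ q *
    ('C(7 - a, 7 - type_a t) * 'C(7 - b, 7 - type_b t))%:R = (q == 1)%:R /\
  \sum_(t < 16) coef_X3Y2 t * type_c t ^+ q *
    ('C(7 - a, 7 - type_a t) * 'C(7 - b, 7 - type_b t))%:R = (q == 2)%:R.
Proof.
rewrite !big_ord_recr !big_ord0 /= /type_a /type_b /type_c /coef_X4Y /coef_X3Y2 /=.
case: q => [|[|[|[|[|[|//]]]]]]; case: a => [|[|[|[|[|[|//]]]]]] //;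
case: b => [|[|[|[|[|[|//]]]]]] // _;
(* Binomials are evaluated first, so that [field] meets only numerals. *)
repeat match goal with |- context [(binomial ?m ?n * binomial ?p ?r)%N] =>
  let c := eval vm_compute in (binomial m n * binomial p r)%N in
  change (binomial m n * binomial p r)%N with c end.
all: split; rewrite /=; by field.
Qed.

End Types.

(** * Positions and generators *)

Notation pos := 'I_(4 * 7).

Definition side (p : pos) : bool := (p < 2 * 7)%N.

Definition pair_of (p : pos) : 'I_7 :=
  inord (if side p then p %/ 2 else (p - 2 * 7) %/ 2)%N.

Lemma rho_subproof (p : pos) :
  ((if side p then 2 * 7 + p.+1 %% (2 * 7) else (p - 2 * 7).+1 %% (2 * 7)) < 4 * 7)%N.
Proof.
have := ltn_pmod p.+1 (isT : (0 < 2 * 7)%N).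
have := ltn_pmod (p - 2 * 7).+1 (isT : (0 < 2 * 7)%N).
by case: ifP => _; lia.
Qed.

(** The position map behind pi: [piv x] is [x \o rho]. It swaps the blocks and shifts cyclically by
    one, hence pairs positions across the boundaries of the original pairs. *)
Definition rho (p : pos) : pos := Ordinal (rho_subproof p).

Lemma even_pos_subproof (s : bool) (x : 'I_7) :
  ((if s then x.*2 else 2 * 7 + x.*2) < 4 * 7)%N.
Proof. by have := ltn_ord x; case: s; lia. Qed.

(** The first position of a pair; [rho] sends it to the second position of the same pair number in
    the other block, so both pairings separate these positions. *)
Definition even_pos (s : bool) (x : 'I_7) : pos := Ordinal (even_pos_subproof s x).

Lemma side_even_pos s x : side (even_pos s x) = s.
Proof. by have := ltn_ord x; rewrite /side; case: s => /=; lia. Qed.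

Lemma pair_even_pos s x : pair_of (even_pos s x) = x.
Proof.
apply: val_inj; rewrite /pair_of side_even_pos /= inordK; have := ltn_ord x.
  by case: s; lia.
by case: s; lia.
Qed.

Lemma side_rho p : side (rho p) = ~~ side p.
Proof.
rewrite {1}/side /=; case: (boolP (side p)) => _; first by rewrite ltnNge leq_addr.
exact: ltn_pmod.
Qed.

Lemma pair_rho_even_pos s x : pair_of (rho (even_pos s x)) = x.
Proof.
apply: val_inj; rewrite /pair_of side_rho side_even_pos /= side_even_pos.
by have := ltn_ord x; case: s => /= xl; rewrite inordK; lia.
Qed.

(* Consecutive positions of a block are paired by [pair_of] or by [pair_of \o rho]. *)
Lemma constant_on_sides (T : Type) (G : pos -> T) :
  (forall p p', side p = side p' -> pair_of p = pair_of p' -> G p = G p') ->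
  (forall p p', side p = side p' -> pair_of (rho p) = pair_of (rho p') -> G p = G p') ->
  forall p p', side p = side p' -> G p = G p'.
Proof.
move=> G1 G2.
have G0 p : G p = G (even_pos (side p) ord0).
  case: p => n; elim: n => [|n IHn] np.
    by congr G; apply: val_inj.
  (* Position 14 opens the second block, a second base case. *)
  have [n13|nn13] := eqVneq n 13%N; first by congr G; apply: val_inj; rewrite /= /side /= n13.
  have np' : (n < 4 * 7)%N by lia.
  have ss : side (Ordinal np) = side (Ordinal np') by rewrite /side /=; lia.
  (* Positions [n] and [n.+1] form a shifted pair for odd [n] and an original pair for even [n]. *)
  rewrite ss -IHn; case: (boolP (odd n)) => on.
    apply: G2 => //; apply: val_inj; rewrite /pair_of !side_rho ss /= ss.
    rewrite /side /=; case: ltnP => n14 /=; congr (val (inord _)).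
      by rewrite !modn_small; lia.
    by rewrite !modn_small; lia.
  apply: G1 => //; apply: val_inj; rewrite /pair_of ss.
  by case: ifP => sn; congr (val (inord _)); move: sn; rewrite /side /=; lia.
by move=> p p' pp'; rewrite (G0 p) (G0 p') pp'.
Qed.

(** * Separation of the two families and spanning of the mixed parts *)

Section Vectors.
Variable R : realType.

Definition side_sum f (k : 'I_5 -> pos) : R :=
  type_sum f (fun i => side (k i)) (fun i => pair_of (k i)).

Lemma type_sum_ext (f : nat -> {set 'I_7} -> {set 'I_7} -> R) s s' x x' :
  s =1 s' -> x =1 x' -> type_sum f s x = type_sum f s' x'.
Proof.
move=> ss' xx'; rewrite /type_sum; apply: eq_bigr => t _; apply: eq_bigr => A _.
apply: eq_bigr => B _; congr (_ * _); apply: eq_bigr => i _.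
by rewrite ss' xx'.
Qed.

Lemma side_sum_ext f (k k' : 'I_5 -> pos) : k =1 k' -> side_sum f k = side_sum f k'.
Proof. by move=> kk'; apply: type_sum_ext => i; rewrite kk'. Qed.

(* [f1] is only sensitive to the pairs of [pair_of] and [f2] to those of
   [pair_of \o rho], so both sums depend on the blocks alone; at [even_pos],
   where both pairings separate the five positions, one of them vanishes as
   second components have at most two pairs. *)
Lemma side_sums_vanish (f1 f2 : nat -> {set 'I_7} -> {set 'I_7} -> R) :
  (forall k : 'I_5 -> pos, side_sum f1 k + side_sum f2 (rho \o k) = 0) ->
  forall k : 'I_5 -> pos, side_sum f1 k = 0 /\ side_sum f2 (rho \o k) = 0.
Proof.
move=> f12.
have f1E k : side_sum f1 k = - side_sum f2 (rho \o k) by apply/eqP; rewrite -addr_eq0 f12.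
have move1 (k : 'I_5 -> pos) i p p' : side p = side p' ->
    side_sum f1 (fun j => if j == i then p else k j) =
    side_sum f1 (fun j => if j == i then p' else k j).
  move: p p'; apply: (constant_on_sides
    (G := fun p => side_sum f1 (fun j => if j == i then p else k j))) => p p' ss pp.
    by apply: type_sum_ext => j; case: ifP.
  rewrite !f1E; congr (- _); apply: type_sum_ext => j /=; case: ifP => //.
  by rewrite !side_rho ss.
have const (k k' : 'I_5 -> pos) : (forall i, side (k i) = side (k' i)) ->
    side_sum f1 k = side_sum f1 k'.
  move=> kk'.
  suff mix m : (m <= 5)%N -> side_sum f1 k =
      side_sum f1 (fun i => if (i < m)%N then k' i else k i).
    by rewrite (mix 5%N) //; apply: side_sum_ext => i; rewrite ltn_ord.
  elim: m => [_|m IHm m5]; first by apply: side_sum_ext.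
  rewrite IHm; last exact: ltnW.
  pose i := Ordinal m5.
  transitivity (side_sum f1
      (fun j => if j == i then k i else if (j < m)%N then k' j else k j)).
    by apply: side_sum_ext => j; case: eqP => [->|//]; rewrite /= ltnn.
  rewrite (move1 _ i _ (k' i)) //; apply: side_sum_ext => j.
  case: eqP => [->|/eqP ji]; first by rewrite /= leqnn.
  by move: ji; rewrite -val_eqE /= ltnS [in RHS]leq_eqVlt => /negbTE ->.
move=> k; suff z1 : side_sum f1 k = 0 by move: (f12 k); rewrite z1 add0r.
pose k' i := even_pos (side (k i)) (widen_ord (isT : (5 <= 7)%N) i).
have injw : injective (widen_ord (isT : (5 <= 7)%N)) by move=> i j [ij]; apply: val_inj.
rewrite (const k k') => [|i]; last by rewrite side_even_pos.
(* Either three indices lie in the second block and the first sum vanishes, or three lie in the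
   first, which [rho] exchanges with the second, and the other sum vanishes. *)
have [h|h] := ltnP 2 #|[pred i | ~~ side (k i)]|.
  rewrite /side_sum (@type_sum_ext _ _ (fun i => side (k i)) _
    (widen_ord (isT : (5 <= 7)%N))).
  - exact: type_sum_eq0.
  - by move=> i; rewrite side_even_pos.
  - by move=> i; rewrite pair_even_pos.
rewrite f1E; apply/eqP; rewrite oppr_eq0; apply/eqP.
rewrite /side_sum (@type_sum_ext _ _ (fun i => ~~ side (k i)) _
  (widen_ord (isT : (5 <= 7)%N))).
- apply: type_sum_eq0 => //.
  have -> : #|[pred i | ~~ ~~ side (k i)]| = #|[predC [pred i | ~~ side (k i)]]|.
    by apply: eq_card.
  have := cardC [pred i | ~~ side (k i)]; rewrite card_ord.
  by move: h; move: #|_| => a; move: #|_| => b; lia.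
- by move=> i /=; rewrite side_rho side_even_pos.
- by move=> i /=; rewrite pair_rho_even_pos.
Qed.

(** A flag for the application of pi, a type, and the index sets of the two blocks; [valid] imposes
    their sizes. *)
Definition generator : finType := ((bool * 'I_16) * ({set 'I_7} * {set 'I_7}))%type.

Definition valid (g : generator) : bool :=
  (#|g.2.1| == type_a g.1.2) && (#|g.2.2| == type_b g.1.2).

Definition gen_vec (g : generator) (p : pos) : R :=
  let p' := if g.1.1 then rho p else p in
  type_val R g.1.2 g.2.1 g.2.2 (side p') (pair_of p').

Definition gen_coef (f : generator -> R) (b : bool) t (A B : {set 'I_7}) : R :=
  f ((b, inord t), (A, B)).

Lemma gen_sumE (f : generator -> R) (k : 'I_5 -> pos) :
  \sum_(g | valid g) f g * \prod_i gen_vec g (k i) =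
  side_sum (gen_coef f false) k + side_sum (gen_coef f true) (rho \o k).
Proof.
pose F g := f g * \prod_i gen_vec g (k i).
have split (bt : bool * 'I_16) : \sum_(AB | valid (bt, AB)) F (bt, AB) =
    \sum_(A : {set 'I_7} | #|A| == type_a bt.2)
      \sum_(B : {set 'I_7} | #|B| == type_b bt.2) F (bt, (A, B)).
  by rewrite pair_big; apply: eq_big => [[A B]|[A B] _].
transitivity (\sum_(bt : bool * 'I_16) \sum_(AB | valid (bt, AB)) F (bt, AB)).
  by rewrite pair_big_dep; apply: eq_big => [[bt AB]|[bt AB] _].
transitivity (\sum_(b : bool) \sum_(t : 'I_16) \sum_(AB | valid ((b, t), AB)) F ((b, t), AB)).
  by rewrite pair_big; apply: eq_big => [[b t]|[b t] _].
rewrite big_bool /= addrC; congr (_ + _); apply: eq_bigr => t _; rewrite split;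
  by apply: eq_bigr => A _; apply: eq_bigr => B _; rewrite /gen_coef inord_val.
Qed.

(** [side_sums_vanish] separates the two families; positions [even_pos] realise every choice of
    sides and pairs, so [all_vanish] treats each family. *)
Lemma generators_independent (f : generator -> R) :
  (forall k : 'I_5 -> pos, \sum_(g | valid g) f g * \prod_i gen_vec g (k i) = 0) ->
  forall g, valid g -> f g = 0.
Proof.
move=> f0 [[b t] [A B]] /andP[/= /eqP cA /eqP cB].
have sums k : side_sum (gen_coef f false) k = 0 /\
    side_sum (gen_coef f true) (rho \o k) = 0.
  by apply: side_sums_vanish => k'; rewrite -gen_sumE.
have -> : f ((b, t), (A, B)) = gen_coef f b t A B by rewrite /gen_coef inord_val.
apply: all_vanish => // s x; case: b.
  have [_ <-] := sums (fun i => even_pos (~~ s i) (x i)).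
  apply: type_sum_ext => i /=; first by rewrite side_rho side_even_pos negbK.
  by rewrite pair_rho_even_pos.
have [<- _] := sums (fun i => even_pos (s i) (x i)).
by apply: type_sum_ext => i /=; rewrite ?side_even_pos ?pair_even_pos.
Qed.

Lemma sym_combination_X4Y (k : 'I_5 -> pos) :
  side_sum (fun t _ _ => coef_X4Y R t) k = (opp_count side k == 1)%:R.
Proof.
rewrite /side_sum type_sum_const (proj1 (coef_system R (admissible_images _ _))).
by rewrite /opp_count -sum1_card big_mkcond.
Qed.

Lemma sym_combination_X3Y2 (k : 'I_5 -> pos) :
  side_sum (fun t _ _ => coef_X3Y2 R t) k = (opp_count side k == 2)%:R.
Proof.
rewrite /side_sum type_sum_const (proj2 (coef_system R (admissible_images _ _))).
by rewrite /opp_count -sum1_card big_mkcond.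
Qed.

Lemma opp_count_rho (k : 'I_5 -> pos) :
  opp_count side (rho \o k) = (5 - opp_count side k)%N.
Proof.
have : (opp_count side (rho \o k) + opp_count side k = 5)%N.
  rewrite /opp_count -big_split /= (eq_bigr (fun=> 1%N)) ?sum1_card ?card_ord //.
  by move=> i _; rewrite side_rho; case: (side _).
by move/(canRL (addnK _)).
Qed.

(** Since [rho] swaps the blocks, the cases 3 and 4 reuse the solutions for 2 and 1 on the second
    family. *)
Definition span_coef (s : nat) (g : generator) : R :=
  match s, g.1.1 with
  | 1, false | 4, true => coef_X4Y R g.1.2
  | 2, false | 3, true => coef_X3Y2 R g.1.2
  | _, _ => 0
  end.

Lemma span_combination s (k : 'I_5 -> pos) : (0 < s < 5)%N ->
  \sum_(g | valid g) span_coef s g * \prod_i gen_vec g (k i) =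
  (opp_count side k == s)%:R.
Proof.
have coefE s' b (e : nat -> R) : (forall t : 'I_16, forall AB,
    span_coef s' ((b, t), AB) = e t) -> forall k' : 'I_5 -> pos,
    side_sum (gen_coef (span_coef s') b) k' = side_sum (fun t _ _ => e t) k'.
  move=> E k'; apply: eq_bigr => t _; apply: eq_bigr => A _; apply: eq_bigr => B _.
  by rewrite /gen_coef E inord_val.
have z (k' : 'I_5 -> pos) : side_sum (fun _ _ _ => 0) k' = 0.
  rewrite /side_sum /type_sum big1 // => t _; rewrite big1 // => A _.
  by rewrite big1 // => B _; rewrite mul0r.
have k5 : (opp_count side k <= 5)%N.
  by have := max_card [pred i | ~~ side (k i)]; rewrite card_ord -sum1_card big_mkcond.
rewrite gen_sumE; case: s => [//|[|[|[|[|//]]]]] _.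
- rewrite (coefE _ _ (coef_X4Y R)) // (coefE _ _ (fun=> 0)) // z addr0.
  exact: sym_combination_X4Y.
- rewrite (coefE _ _ (coef_X3Y2 R)) // (coefE _ _ (fun=> 0)) // z addr0.
  exact: sym_combination_X3Y2.
- rewrite (coefE _ _ (fun=> 0)) // (coefE _ _ (coef_X3Y2 R)) // z add0r.
  by rewrite sym_combination_X3Y2 opp_count_rho; congr _%:R; lia.
- rewrite (coefE _ _ (fun=> 0)) // (coefE _ _ (coef_X4Y R)) // z add0r.
  by rewrite sym_combination_X4Y opp_count_rho; congr _%:R; lia.
Qed.

(** Five distinct pairs of one block do not fit into index sets of size at most 4. *)
Lemma gen_vec_even_pos g s (x : 'I_5 -> 'I_7) : valid g -> injective x ->
  \prod_i gen_vec g (even_pos s (x i)) = 0.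
Proof.
case/andP=> /eqP cA /eqP cB injx.
pose s' := s (+) g.1.1.
have -> : \prod_i gen_vec g (even_pos s (x i)) =
    \prod_i type_val R g.1.2 g.2.1 g.2.2 s' (x i).
  apply: eq_bigr => i _; rewrite /gen_vec /s'; case: (g.1.1) => /=.
    by rewrite side_rho side_even_pos pair_rho_even_pos addbT.
  by rewrite side_even_pos pair_even_pos addbF.
rewrite (prod_type_val R g.1.2 g.2.1 g.2.2 (fun=> s') x).
case: andP => [[]|]; last by rewrite mulr0.
have t4 t : (type_a t < 5)%N /\ (type_b t < 5)%N.
  by rewrite /type_a /type_b; do 16 (case: t => [//|t]); rewrite /= !nth_nil.
have full (P : pred 'I_5) : P =1 predT -> #|[set i | P i]| = 5%N.
  by move=> PT; rewrite cardsE (eq_card PT) card_ord.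
move=> /subset_leq_card + /subset_leq_card; rewrite !card_imset // cA cB.
have [t4a t4b] := t4 g.1.2.
case: s' => h1 h2.
  by move: h1; rewrite full // leqNgt t4a.
by move: h2; rewrite full // leqNgt t4b.
Qed.

End Vectors.

(** * The tensor of the theorem *)

Section BinaryForm.
Variables (R : realType) (C : tensor R 'I_2 6).
Hypothesis symC : symmetric_tensor C.
Hypothesis formC : forall x : 'I_2 -> R,
  tensor_form C x = x ord0 ^+ 6 - 3 * x ord_max ^+ 6.

Definition ones (k : {ffun 'I_6 -> 'I_2}) : nat := #|[pred i | k i == ord_max]|.

Lemma ord2_cases (i : 'I_2) : i = ord0 \/ i = ord_max.
Proof. by case: i => [[|[|//]]] i2; [left|right]; apply: val_inj. Qed.

(** Two index tuples with equally many ones are permutations of each other. *)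
Lemma symmetric_ones k k' : ones k = ones k' -> C k = C k'.
Proof.
move=> kk'.
have /tuple_permP[s sE] : perm_eq [tuple k i | i < 6] [tuple k' i | i < 6].
  have count1 (l : {ffun 'I_6 -> 'I_2}) : count (preim l (pred1 ord_max)) (enum 'I_6) = ones l.
    by rewrite -sum1_count big_enum_cond /= sum1_card.
  have count0 (l : {ffun 'I_6 -> 'I_2}) : count (preim l (pred1 ord0)) (enum 'I_6) = (6 - ones l)%N.
    have := count_predC (preim l (pred1 ord_max)) (enum 'I_6).
    rewrite count1 size_enum_ord => /(canRL (addKn _)) <-; apply: eq_count => i /=.
    by case: (ord2_cases (l i)) => ->.
  apply/allP => P _; apply/eqP.
  have mapE (l : {ffun 'I_6 -> 'I_2}) :
      count_mem P [tuple l i | i < 6] = count (preim l (pred1 P)) (enum 'I_6).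
    by rewrite -val_ord_tuple -count_map.
  rewrite !mapE.
  case: (ord2_cases P) => ->.
    by apply: etrans (count0 k) _; rewrite kk'; apply/esym/count0.
  by apply: etrans (count1 k) _; rewrite kk'; apply/esym/count1.
rewrite -(symC s k'); congr (C _); apply/ffunP => i; rewrite ffunE.
have := congr1 (fun u => nth ord0 u i) sE.
rewrite /= (nth_map i) ?size_enum_ord // nth_ord_enum => ->.
by rewrite (nth_map i) ?size_enum_ord // nth_ord_enum tnth_mktuple.
Qed.

(** The form at [(1, t)]: both sides have degree at most 6 in [t] and agree at 0, ..., 6. *)
Lemma binary_form_poly :
  \sum_k C k *: 'X^(ones k) = 1 - 3 *: 'X^6 :> {poly R}.
Proof.
set P := LHS; apply/eqP; rewrite -subr_eq0; apply/eqP.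
apply: (@roots_geq_poly_eq0 _ _ [seq i%:R | i <- iota 0 7]).
- apply/allP => _ /mapP[i _ ->]; rewrite rootE hornerD hornerN horner_sum.
  rewrite hornerD hornerN hornerZ hornerXn -polyC1 hornerC subr_eq0; apply/eqP.
  pose x (j : 'I_2) : R := if j == ord_max then i%:R else 1.
  have := formC x; rewrite {2}/x {2}/x /= expr1n => <-.
  apply: eq_bigr => k _; rewrite hornerZ hornerXn; congr (_ * _).
  rewrite -prodr_const [LHS]big_mkcond; apply: eq_bigr => j _.
  by rewrite inE /x.
- by rewrite map_inj_uniq ?iota_uniq //; exact: (mulrIn (oner_neq0 R)).
- rewrite size_map size_iota; apply: leq_trans (size_polyD _ _) _.
  rewrite geq_max size_polyN; apply/andP; split.
    apply: leq_trans (size_sum _ _ _) _; apply/bigmax_leqP => k _.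
    apply: leq_trans (size_scale_leq _ _) _; rewrite size_polyXn ltnS.
    by rewrite -[6%N](card_ord 6) max_card.
  apply: leq_trans (size_polyD _ _) _; rewrite geq_max size_poly1 size_polyN.
  by apply: leq_trans (size_scale_leq _ _) _; rewrite size_polyXn.
Qed.

(** A coefficient of the form is the entry times the size of its symmetry class; the class is a
    singleton at the two extremes, and in between the coefficient is 0 and characteristic zero
    applies. *)
Lemma binary_form_entry k :
  C k = \prod_i (k i == ord0)%:R - 3 * \prod_i (k i == ord_max)%:R.
Proof.
have coefk : C k *+ #|[pred k' | ones k' == ones k]| =
    (ones k == 0)%:R - 3 * (ones k == 6)%:R.
  have := congr1 (fun p : {poly R} => p`_(ones k)) binary_form_poly.
  rewrite !(coefB, coefZ, coefXn, coef1) => <-; rewrite coef_sum -sumr_const.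
  rewrite [LHS]big_mkcond; apply: eq_bigr => k' _; rewrite inE coefZ coefXn eq_sym.
  by case: eqP => [/symmetric_ones ->|_]; rewrite ?mulr1 ?mulr0.
have prodE (j : 'I_2) : \prod_i (k i == j)%:R = [forall i, k i == j]%:R :> R.
  have [/forallP kj|] := boolP [forall i, k i == j].
    by rewrite big1 // => i _; rewrite kj.
  by rewrite negb_forall => /existsP[i /negbTE ki]; rewrite (bigD1 i) //= ki mul0r.
have all0 (l : {ffun 'I_6 -> 'I_2}) : (ones l == 0)%N = [forall i, l i == ord0].
  apply/pred0P/forallP => [H i|H i] /=.
    by have := H i; rewrite /=; case: (ord2_cases (l i)) => ->.
  by rewrite (eqP (H i)).
have all1 (l : {ffun 'I_6 -> 'I_2}) : (ones l == 6)%N = [forall i, l i == ord_max].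
  rewrite -[6%N in LHS](card_ord 6); apply/eqP/forallP => [H i|H].
    by have /(_ i) := subset_cardP H (subset_predT _); rewrite !inE.
  by apply: eq_card => i; rewrite !inE H.
have unique j : [forall i, k i == j] ->
    (forall l : {ffun 'I_6 -> 'I_2}, (ones l == ones k) = [forall i, l i == j]) ->
    #|[pred k' | ones k' == ones k]| = 1%N.
  move=> /forallP kj E; apply: (@eq_card1 _ k) => l; rewrite !inE E.
  apply/forallP/eqP => [lj|-> //]; apply/ffunP => i.
  by rewrite (eqP (lj i)) (eqP (kj i)).
rewrite !prodE -all0 -all1 -coefk.
have [k0|k0] := eqVneq (ones k) 0%N.
  by rewrite (unique ord0) ?mulr1n -?all0 ?k0 // => l; rewrite k0 all0.
have [k6|k6] := eqVneq (ones k) 6%N.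
  by rewrite (unique ord_max) ?mulr1n -?all1 ?k6 // => l; rewrite k6 all1.
move/eqP: coefk; rewrite (negbTE k0) (negbTE k6) mulr0 subrr mulrn_eq0.
case/orP => [/eqP c0|/eqP ->]; last by rewrite mul0rn.
by have := card0_eq c0 k; rewrite !inE eqxx.
Qed.

Lemma clone_entry (k : {ffun 'I_6 -> pos}) : clone 7 C k =
  \prod_i (side (k i))%:R - 3 * \prod_i (~~ side (k i))%:R.
Proof.
rewrite ffunE binary_form_entry; congr (_ - 3 * _); apply: eq_bigr => i _;
  by rewrite ffunE /side; case: ifP.
Qed.

Lemma SAdj_adjoined (Ws : seq (tensor R pos 5)) (u : seq_sub Ws -> pos -> R)
    (k : {ffun 'I_6 -> AdjIdx Ws}) : (forall w, val w = tpow 5 (u w)) ->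
  SAdj (clone 7 C) Ws k =
  adjoined (fun p => (side p)%:R) (fun p => (~~ side p)%:R) u k.
Proof.
move=> uE; rewrite ffunE; case: pickP => [k' /eqP ->|noI].
  rewrite /adjoined clone_entry [X in _ = _ + X]big1 ?addr0 => [|j _].
    by congr (_ - 3 * _); apply: eq_bigr => i _; rewrite ffunE.
  by rewrite big1 // => w _; rewrite (bigD1 j) //= eqxx ffunE mul0r.
have [j [w kj]] : exists j w, k j = inr w.
  suff /existsP[j] : [exists j, if k j is inr _ then true else false].
    by case kj: (k j) => [//|w] _; exists j, w.
  apply: contraFT (noI [ffun i => if k i is inl p then p else even_pos true ord0]).
  rewrite negb_exists => /forallP kI; apply/eqP/ffunP => i; rewrite !ffunE.
  by case: (k i) (kI i).
have z (x : pos -> R) : \prod_i sum_fun x (fun=> 0) (k i) = 0.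
  by rewrite (bigD1 j) //= kj mul0r.
rewrite /adjoined !z mulr0 subrr add0r (bigD1 j) //= [X in _ + X]big1 => [|j' jj']; last first.
  rewrite big1 // => w' _.
  by rewrite (bigD1 j) //= eq_sym (negbTE jj') kj /= mul0r.
rewrite addr0 (bigD1 w) //= [X in _ + X]big1 ?addr0 => [|w' ww']; last first.
  by rewrite (bigD1 j) //= eqxx kj /= eq_sym (negbTE ww') mul0r.
rewrite (bigD1 j) //= eqxx kj /= eqxx mul1r prod_lift.
case: pickP => [[[j' w'] k5] /= /andP[/eqP kj' /forallP k5E]|nope].
  have jj' : j = j'.
    apply/eqP; apply: contraT; rewrite eq_sym => /unlift_some[t tE _].
    by have := k5E t; rewrite -tE kj.
  move: kj' k5E; rewrite -jj' kj => -[<-] k5E.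
  rewrite uE ffunE; apply: eq_bigr => t _.
  by rewrite eq_sym (negbTE (neq_lift j t)) (eqP (k5E t)).
(* As the search failed, another index is adjoined and gives a factor 0; the fallback position only
   makes the candidate total. *)
apply/esym/eqP; rewrite prodf_seq_eq0; apply: contraFT (nope ((j, w),
  [ffun t => if k (lift j t) is inl p then p else even_pos true ord0])) => /=.
rewrite -all_predC kj eqxx /= => /allP H; apply/forallP => t; rewrite ffunE.
have := H t (mem_index_enum t); rewrite /= [lift j t == j]eq_sym (negbTE (neq_lift j t)).
by case: (k (lift j t)) => [p|w'] //=; rewrite eqxx.
Qed.

End BinaryForm.

(** * The set of adjoined tensors and its cardinality *)

Section Wset.
Variable R : realType.

Lemma vnat_val N (x : 'I_N -> R) (i : 'I_N) : vnat x i = x i.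
Proof. by rewrite /vnat valK. Qed.

Lemma asum_pair (A : {set 'I_7}) (p : 'I_(2 * 7)) :
  asum R A p = (inord (p %/ 2) \in A)%:R.
Proof.
have p7 : (p %/ 2 < 7)%N by rewrite ltn_divLR // mulnC.
rewrite /asum /alpha; have [iA|iA] := boolP (inord _ \in A).
  rewrite (bigD1 (inord (p %/ 2))) //= inordK // eqxx big1 ?addr0 // => j.
  by case/andP=> _ /eqP nj; case: eqP => // pj; case: nj; rewrite pj inord_val.
rewrite big1 // => j jA; case: eqP => // pj.
by move: iA; rewrite pj inord_val jA.
Qed.

Lemma cat2_type_val t (A B : {set 'I_7}) (p : pos) :
  cat2 (asum R A) (fun q => type_c R t * asum R B q) p =
  type_val R t A B (side p) (pair_of p).
Proof.
rewrite /cat2 /type_val /pair_of /side; case: ifP => ps.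
  by rewrite -[val p]/(val (Ordinal ps)) vnat_val asum_pair.
have ps' : (p - 2 * 7 < 2 * 7)%N by have := ltn_ord p; lia.
by rewrite -[(p - 2 * 7)%N]/(val (Ordinal ps')) vnat_val asum_pair.
Qed.

Lemma piv_rho (x : pos -> R) p : piv x p = x (rho p).
Proof. by rewrite /piv -vnat_val. Qed.

Lemma Ulist_types : Ulist R 7 =
  flatten [seq utype 7 (type_a t) (type_b t) (type_c R t) | t <- iota 0 16].
Proof.
rewrite /Ulist /=.
have -> : (7 - 2) ^+ 2 / ((7 - 3) * (7 - 1)) = 25 / 24 :> R by field.
have -> : (7 - 2) / (7 - 3) = 5 / 4 :> R by field.
have -> : (7 - 1) / (7 - 4) = 2 :> R by field.
have -> : (7 - 2) / (7 - 4) = 5 / 3 :> R by field.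
have -> : (7 - 3) / (7 - 4) = 4 / 3 :> R by field.
have -> : (7 - 2) / (7 - 1) = 5 / 6 :> R by field.
have -> : (7 - 1) / (7 - 3) = 3 / 2 :> R by field.
by rewrite cats0.
Qed.

Definition gen_tensor (g : generator) : tensor R pos 5 := tpow 5 (gen_vec R g).

(** Two generators with the same tensor would give a relation with coefficients 1 and -1. *)
Lemma gen_tensor_inj : {in valid &, injective gen_tensor}.
Proof.
move=> g g' gv g'v E; apply/eqP; apply: contraT => gg'.
pose f h : R := (h == g)%:R - (h == g')%:R.
have sum1 (h : generator) (G : generator -> R) : valid h ->
    \sum_(h' | valid h') (h' == h)%:R * G h' = G h.
  move=> hv; rewrite (bigD1 h) //= eqxx mul1r big1 ?addr0 // => h' /andP[_ /negbTE ->].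
  by rewrite mul0r.
suff : f g = 0.
  by rewrite /f eqxx (negbTE gg') subr0 => /eqP; rewrite oner_eq0.
apply: (generators_independent _ gv) => k.
pose G h := \prod_i gen_vec R h (k i).
have GE h : gen_tensor h (finfun k) = G h.
  by rewrite ffunE; apply: eq_bigr => i _; rewrite ffunE.
transitivity (\sum_(h | valid h) (h == g)%:R * G h - \sum_(h | valid h) (h == g')%:R * G h).
  by rewrite -sumrB; apply: eq_bigr => h _; rewrite -mulrBl.
transitivity (G g - G g'); last by rewrite -(GE g) -(GE g') E subrr.
by congr (_ - _); apply: sum1.
Qed.

Lemma mem_Wlist T : (T \in Wlist R 7) = (T \in [seq gen_tensor g | g <- enum valid]).
Proof.
have memU (h : ('I_(4 * 7) -> R) -> tensor R pos 5) b :
    (forall (t : 'I_16) (A B : {set 'I_7}), #|A| = type_a t -> #|B| = type_b t ->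
      h (cat2 (asum R A) (fun q => type_c R t * asum R B q)) = gen_tensor ((b, t), (A, B))) ->
    T \in [seq h u | u <- Ulist R 7] <-> exists2 g, valid g && (g.1.1 == b) & T = gen_tensor g.
  move=> hE; rewrite Ulist_types map_flatten -map_comp.
  have block t : (map h \o (fun t => utype 7 (type_a t) (type_b t) (type_c R t))) t =
      [seq h (cat2 (asum R A) (fun q => type_c R t * asum R B q)) |
        A <- ksub 7 (type_a t), B <- ksub 7 (type_b t)].
    by rewrite /= map_allpairs.
  split.
    case/flatten_mapP=> t t16; rewrite block => /allpairsP[[A B] /= [+ + ->]].
    rewrite !mem_enum !inE => /eqP cA /eqP cB.
    rewrite mem_iota in t16; exists ((b, Ordinal t16), (A, B)).
      by rewrite /valid /= cA cB !eqxx.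
    by rewrite (hE (Ordinal t16)).
  case=> [[[b' t] [A B]]] /andP[/andP[/eqP cA /eqP cB] /eqP bb] ->.
  rewrite /= in cA cB bb; rewrite bb.
  rewrite -hE //; apply/flatten_mapP; exists (val t); first by rewrite mem_iota ltn_ord.
  by rewrite block; apply/allpairsP; exists (A, B); rewrite !mem_enum !inE cA cB.
have m1 : T \in [seq tpow 5 u | u <- Ulist R 7] <->
    exists2 g, valid g && (g.1.1 == false) & T = gen_tensor g.
  apply: (memU (tpow 5)) => t A B cA cB; apply/ffunP => k; rewrite !ffunE.
  by apply: eq_bigr => i _; exact: cat2_type_val.
have m2 : T \in [seq tpow 5 (piv u) | u <- Ulist R 7] <->
    exists2 g, valid g && (g.1.1 == true) & T = gen_tensor g.
  apply: (memU (fun u => tpow 5 (piv u))) => t A B cA cB; apply/ffunP => k.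
  by rewrite !ffunE; apply: eq_bigr => i _; rewrite piv_rho cat2_type_val.
rewrite mem_undup mem_cat; apply/orP/mapP => [[/m1|/m2]|[g]].
- by case=> g /andP[gv _] ->; exists g => //; rewrite mem_enum.
- by case=> g /andP[gv _] ->; exists g => //; rewrite mem_enum.
rewrite mem_enum => gv Tg; case gb: (g.1.1); [right|left].
  by apply/m2; exists g; rewrite // gb andbT.
by apply/m1; exists g; rewrite // gb andbT.
Qed.

Lemma card_valid : #|valid| = 5152%N.
Proof.
have cardk k : #|[pred A : {set 'I_7} | #|A| == k]| = 'C(7, k).
  have := card_draws 'I_7 k; rewrite card_ord => <-.
  by apply: eq_card => A; rewrite !inE.
transitivity (\sum_(b : bool) \sum_(t < 16) 'C(7, type_a t) * 'C(7, type_b t))%N.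
  rewrite pair_big /= -sum1_card.
  transitivity (\sum_(bt : bool * 'I_16) \sum_(AB | valid (bt, AB)) 1)%N.
    by rewrite pair_big_dep; apply: eq_bigl => [[bt AB]].
  apply: eq_bigr => [[b t]] _ /=; rewrite -!cardk -cardX.
  by rewrite sum1_card; apply: eq_card => [[A B]]; rewrite !inE.
rewrite sum_nat_const card_bool !big_ord_recr big_ord0 /=.
by vm_compute.
Qed.

Lemma size_Wlist : size (Wlist R 7) = 5152%N.
Proof.
rewrite -card_valid cardE -(size_map gen_tensor); apply/perm_size/uniq_perm.
- exact: undup_uniq.
- rewrite map_inj_in_uniq ?enum_uniq // => g g'; rewrite !mem_enum.
  exact: gen_tensor_inj.
- exact: mem_Wlist.
Qed.

End Wset.

(** * Transfer from generators to the adjoined tensors *)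

Section Generators.
Variables (R : realType) (gen : seq_sub (Wlist R 7) -> generator).
Hypothesis gen_valid : forall w, valid (gen w).
Hypothesis genE : forall w, val w = gen_tensor R (gen w).

Lemma Wlist_independent : independent5 (fun w => gen_vec R (gen w)).
Proof.
move=> y y0 w.
pose f g := \sum_(w' | gen w' == g) y w'.
have gen_inj : injective gen by move=> w1 w2 w12; apply: val_inj; rewrite !genE w12.
have <- : f (gen w) = y w.
  by rewrite /f (big_pred1 w) // => w'; rewrite /= (inj_eq gen_inj).
apply: (@generators_independent R f _ (gen w) (gen_valid w)) => k.
rewrite -[RHS](y0 k) [RHS](partition_big gen valid) //=; apply: eq_bigr => g _.
by rewrite mulr_suml; apply: eq_bigr => w' /eqP ->.
Qed.

Lemma Wlist_sym_combination s : (0 < s < 5)%N ->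
  sym_combination side (fun w => gen_vec R (gen w)) s
    (fun w => \sum_(g | valid g && (gen_tensor R g == val w)) span_coef R s g).
Proof.
move=> s5 m; rewrite -span_combination //.
have genT g : gen_tensor R g (finfun m) = \prod_i gen_vec R g (m i).
  by rewrite ffunE; apply: eq_bigr => i _; rewrite ffunE.
have memT g : valid g -> gen_tensor R g \in Wlist R 7.
  by move=> gv; rewrite mem_Wlist map_f // mem_enum.
transitivity (\sum_(w : seq_sub (Wlist R 7)) \sum_(g | valid g && (gen_tensor R g == val w))
    span_coef R s g * \prod_i gen_vec R g (m i)).
  apply: eq_bigr => w _; rewrite mulr_suml; apply: eq_bigr => g /andP[_ /eqP gw].
  by rewrite -!genT -genE gw.
rewrite (exchange_big_dep valid) /=; last by move=> w g _ /andP[].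
apply: eq_bigr => g gv; rewrite (big_pred1 (SeqSub (memT g gv))) // => w.
by rewrite gv /= eq_sym.
Qed.

End Generators.

Lemma exists_generators (R : realType) :
  exists gen : seq_sub (Wlist R 7) -> generator,
    (forall w, valid (gen w)) /\ forall w, val w = gen_tensor R (gen w).
Proof.
have /fin_all_exists[gen genP] : forall w : seq_sub (Wlist R 7),
    exists g, valid g /\ val w = gen_tensor R g.
  move=> w; have := valP w; rewrite mem_Wlist => /mapP[g].
  by rewrite mem_enum => gv gw; exists g.
by exists gen; split=> w; case: (genP w).
Qed.


(** * Rank and symmetric rank of the adjoined clone *)

Theorem theorem5p2 (R : realType) (C : tensor R 'I_2 6) :
  symmetric_tensor C ->
  (forall x : 'I_2 -> R, tensor_form C x = x ord0 ^+ 6 - 3 * x ord_max ^+ 6) ->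
  let Ws := Wlist R 7 in
  let S := SAdj (clone 7 C) Ws in
  size Ws = 5152%N /\
  #|AdjIdx Ws| = 5180%N /\
  symmetric_tensor S /\ is_rank S 30913 /\ is_sym_rank S 30914.
Proof.
move=> symC formC Ws S.
have cW : #|{: seq_sub Ws}| = 5152%N.
  by rewrite card_seq_sub ?size_Wlist // undup_uniq.
have [gen [gen_valid genE]] := exists_generators R.
pose u w := gen_vec R (gen w).
pose X (p : pos) : R := (side p)%:R; pose Y (p : pos) : R := (~~ side p)%:R.
have SE k : S k = adjoined X Y u k by apply: SAdj_adjoined.
have indep : independent5 u by apply: Wlist_independent.
have uz b (s : 'I_5 -> 'I_7) w : injective s -> \prod_t u w (even_pos b (s t)) = 0.
  by apply: gen_vec_even_pos.
have XY : [/\ forall x, X (even_pos true x) = 1, forall x, Y (even_pos true x) = 0,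
              forall x, X (even_pos false x) = 0 & forall x, Y (even_pos false x) = 1].
  by split=> x; rewrite /X /Y side_even_pos.
case: XY => Xe Ye Xe' Ye'.
have symS : sym_rank_le S (6 * #|{: seq_sub Ws}| + 2).
  have [lam [v vE]] := adjoined_sym_rank_upper side u.
  by exists lam, v; apply/ffunP => k; rewrite SE vE ffunE.
split; first exact: size_Wlist.
split; first by rewrite card_sum card_ord cW.
split.
  (* Symmetry is read off a symmetric decomposition. *)
  case: symS => lam [v ->] s k; rewrite !ffunE; apply: eq_bigr => j _; congr (_ * _).
  rewrite [RHS](reindex_inj (@perm_inj _ s)).
  by apply: eq_bigr => i _; rewrite ffunE.
have -> : 30913%N = (6 * #|{: seq_sub Ws}| + 1)%N by rewrite cW; vm_compute.
have -> : 30914%N = (6 * #|{: seq_sub Ws}| + 2)%N by rewrite cW; vm_compute.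
split; split=> //.
- have [v vE] := adjoined_rank_upper (Wlist_sym_combination genE).
  by exists v; apply/ffunP => k; rewrite SE vE ffunE.
- move=> r [v vE]; rewrite addn1.
  apply: (adjoined_rank_lower (lam := fun=> 1) (v := v) indep Xe Ye (uz true)) => k.
  by rewrite -SE vE ffunE; apply: eq_bigr => j _; rewrite mul1r.
- move=> r [lam [v vE]]; rewrite addn2 -addn1.
  apply: (adjoined_sym_rank_lower (lam := lam) (v := v) indep Xe Ye Xe' Ye'
    (uz true) (uz false)) => k.
  by rewrite -SE vE ffunE.
Qed.
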